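(* Let $g\in H$, $b>0$ and $q\in Q$. Then for each $h>0$ there exists a unique $u_{hg}\in K_h$ such that $$a(u_{hg},v_h-u_{hg})\ \geq\ (g,v_h-u_{hg})_H-\int_{\Gamma_2}q\,(v_h-u_{hg})\,d\gamma\qquad\forall\, v_h\in K_h .$$
   Context: $\Omega\subset\mathbb{R}^n$ is a bounded polygonal domain whose boundary $\partial\Omega=\Gamma_1\cup\Gamma_2$ is the union of two disjoint portions $\Gamma_1,\Gamma_2$ with $\mathrm{meas}(\Gamma_1)>0$. Set $V=H^1(\Omega)$, $H=L^2(\Omega)$ with inner product $(u,v)_H=\int_\Omega uv\,dx$, $Q=L^2(\Gamma_2)$, and $a(u,v)=\int_\Omega\nabla u\cdot\nabla v\,dx$ for $u,v\in V$. Boundary values are taken in the sense of traces. With $V_0=\{v\in V: v|_{\Gamma_1}=0\}$, the form $a$ is bilinear, continuous and symmetric on $V$ and coercive on $V_0$: there is $\lambda>0$ with $a(v,v)\ge\lambda\|v\|_V^2$ for all $v\in V_0$. The number $b$ is a constant. Finite elements: $\tau_h$ is a regular triangulation of $\Omega$ with Lagrange triangles of type 1 (affine-equivalent finite elements of class $C^0$), where $h>0$ is the longest side of the triangles $T\in\tau_h$. $\mathbb{P}_1(T)$ is the set of polynomials of degree at most $1$ on $T$, and $$K_h=\{v_h\in C^0(\overline{\Omega}): v_h\ge 0,\ v_h|_{\Gamma_1}=b,\ v_h|_T\in\mathbb{P}_1(T)\ \forall\,T\in\tau_h\}.$$ *)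

(* Defs.v *)
From HB Require Import structures.
From mathcomp Require Import all_boot all_order all_algebra.
From mathcomp Require Import all_classical all_reals all_analysis.

Set Implicit Arguments.
Unset Strict Implicit.
Unset Printing Implicit Defensive.

Import Order.TTheory GRing.Theory Num.Theory.
Import numFieldNormedType.Exports.

Local Open Scope classical_set_scope.
Local Open Scope ring_scope.

(* R^n is 'rV[R]_n.  Its Borel sigma-algebra is generated by the coordinates,
   exactly as the library does for n.-tuple. *)
Section borel_rV.
Variables (R : realType) (n : nat).

Let coors : 'I_n -> 'rV[R]_n -> R := fun i x => x ord0 i.

Let rV_set0 : g_sigma_preimage coors set0.
Proof. exact: sigma_algebra0. Qed.

Let rV_setC A : g_sigma_preimage coors A -> g_sigma_preimage coors (~` A).
Proof. exact: sigma_algebraC. Qed.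

Let rV_bigcup (F : _^nat) : (forall i, g_sigma_preimage coors (F i)) ->
  g_sigma_preimage coors (\bigcup_i (F i)).
Proof. exact: sigma_algebra_bigcup. Qed.

HB.instance Definition _ := @isMeasurable.Build
  (measure_tuple_display default_measure_display)
  'rV[R]_n (g_sigma_preimage coors) rV_set0 rV_setC rV_bigcup.

Lemma measurable_coord (i : 'I_n) :
  measurable_fun [set: 'rV[R]_n] (fun x : 'rV[R]_n => x ord0 i).
Proof.
move=> _ Y mY; rewrite setTI; apply: sub_sigma_algebra => /=.
rewrite -bigcup_seq/=; exists i => /=; first by rewrite mem_index_enum.
by exists Y => //; rewrite setTI.
Qed.

Lemma measurable_fun_rV d (T : measurableType d) (f : T -> 'rV[R]_n) :
  (forall i, measurable_fun [set: T] (fun t => f t ord0 i)) ->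
  measurable_fun [set: T] f.
Proof.
move=> mf; apply: (@measurability _ _ _ _ _ _
  (\big[setU/set0]_(i < n) preimage_set_system setT (coors i) measurable)) => //.
move=> _ [B + <-]; rewrite -bigcup_seq => -[i _ [Y mY <-]].
by rewrite setTI; exact: (mf i measurableT Y mY).
Qed.

End borel_rV.

Section lebesgue_rV.
Variable R : realType.

Definition cons_rV n (x : R * 'rV[R]_n) : 'rV[R]_n.+1 :=
  row_mx (x.1)%:M x.2.

Definition uncons_rV n (v : 'rV[R]_n.+1) : R * 'rV[R]_n :=
  (v ord0 ord0, \row_j v ord0 (lift ord0 j)).

Lemma cons_rV0 n (x : R * 'rV[R]_n) : cons_rV x ord0 ord0 = x.1.
Proof.
rewrite /cons_rV (_ : ord0 = lshift n (ord0 : 'I_1)); last exact: val_inj.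
by rewrite (@row_mxEl _ 1 1 n) mxE eqxx.
Qed.

Lemma cons_rVS n (x : R * 'rV[R]_n) j :
  cons_rV x ord0 (lift ord0 j) = x.2 ord0 j.
Proof.
rewrite /cons_rV (_ : lift ord0 j = rshift 1 j); last exact: val_inj.
by rewrite (@row_mxEr _ 1 1 n).
Qed.

Lemma cons_rVK n : cancel (@cons_rV n) (@uncons_rV n).
Proof.
case=> a v; rewrite /uncons_rV cons_rV0; congr (_, _).
by apply/rowP => j; rewrite mxE cons_rVS.
Qed.

Lemma measurable_cons_rV n : measurable_fun [set: R * 'rV[R]_n] (@cons_rV n).
Proof.
apply: measurable_fun_rV => i; case: (unliftP ord0 i) => [j ->|->].
  under eq_fun do rewrite cons_rVS.
  exact: (measurableT_comp (@measurable_coord R n j) measurable_snd).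
under eq_fun do rewrite cons_rV0.
exact: measurable_fst.
Qed.

Lemma measurable_uncons_rV n : measurable_fun [set: 'rV[R]_n.+1] (@uncons_rV n).
Proof.
rewrite /uncons_rV; apply: measurable_fun_pair; first exact: measurable_coord.
apply: measurable_fun_rV => i.
under eq_fun do rewrite mxE.
exact: measurable_coord.
Qed.

Section succ.
Variables (n : nat) (mu : {sigma_finite_measure set 'rV[R]_n -> \bar R}).

Definition lebesgue_rV_succ : set 'rV[R]_n.+1 -> \bar R :=
  pushforward (lebesgue_measure \x mu)%E (@cons_rV n).

Let lebesgue_rV_succ0 : lebesgue_rV_succ set0 = 0%E.
Proof. by rewrite /lebesgue_rV_succ /pushforward preimage_set0 measure0. Qed.

Let lebesgue_rV_succ_ge0 A : (0 <= lebesgue_rV_succ A)%E.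
Proof. by rewrite /lebesgue_rV_succ /pushforward measure_ge0. Qed.

Let lebesgue_rV_succ_sigma_additive : semi_sigma_additive lebesgue_rV_succ.
Proof.
have mcons B : measurable B -> measurable (@cons_rV n @^-1` B).
  by move=> mB; rewrite -[X in measurable X]setTI; exact: measurable_cons_rV.
move=> F mF tF mUF; rewrite /lebesgue_rV_succ /pushforward preimage_bigcup.
apply: measure_semi_sigma_additive => [k||]; first exact: mcons.
  apply/trivIsetP => /= i j _ _ ij; rewrite -preimage_setI.
  by move/trivIsetP : tF => /(_ _ _ _ _ ij) ->//; rewrite preimage_set0.
by rewrite -preimage_bigcup; exact: mcons.
Qed.

HB.instance Definition _ := isMeasure.Build _ _ _ lebesgue_rV_succ
  lebesgue_rV_succ0 lebesgue_rV_succ_ge0 lebesgue_rV_succ_sigma_additive.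

Let lebesgue_rV_succ_sigma_finite : sigma_finite setT lebesgue_rV_succ.
Proof.
have /sigma_finiteP[F [TF ndF Foo]] := sigma_finiteT (@lebesgue_measure R).
have /sigma_finiteP[G [TG ndG Goo]] := sigma_finiteT mu.
exists (fun k => @uncons_rV n @^-1` (F k `*` G k)).
  rewrite -preimage_bigcup -(preimage_setT (@uncons_rV n)); congr (_ @^-1` _).
  apply/esym/seteqP; split => // -[x y] _.
  have [i _ Fix] : (\bigcup_i F i) x by rewrite -TF.
  have [j _ Gjy] : (\bigcup_i G i) y by rewrite -TG.
  exists (maxn i j) => //; split => /=.
    by move: x Fix; exact/subsetPset/ndF/leq_maxl.
  by move: y Gjy; exact/subsetPset/ndG/leq_maxr.
move=> k; have [mF Fk] := Foo k; have [mG Gk] := Goo k; split.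
  rewrite -[X in measurable X]setTI.
  exact: (measurable_uncons_rV measurableT (measurableX mF mG)).
rewrite /lebesgue_rV_succ /pushforward -comp_preimage.
rewrite (_ : _ \o _ = id); last by apply/funext => x /=; rewrite cons_rVK.
by rewrite preimage_id product_measure1E// lte_mul_pinfty// ge0_fin_numE.
Qed.

HB.instance Definition _ := Measure_isSigmaFinite.Build _ _ _ lebesgue_rV_succ
  lebesgue_rV_succ_sigma_finite.

End succ.

Fixpoint lebesgue_rV n : {sigma_finite_measure set 'rV[R]_n -> \bar R} :=
  match n with
  | 0%N => \d_(0 : 'rV[R]_0)
  | m.+1 => lebesgue_rV_succ (lebesgue_rV m)
  end.

End lebesgue_rV.

(* The library's norm on 'rV[R]_n is the sup norm. *)
Definition enorm (R : realType) n (x : 'rV[R]_n) : R :=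
  Num.sqrt (\sum_i x ord0 i ^+ 2).

(* s-dimensional Hausdorff measure on R^n, normalised by the volume of the
   Euclidean unit ball of R^s so that it is the usual surface measure on
   s-dimensional polyhedral sets. *)
Section hausdorff.
Variables (R : realType) (n s : nat).

Definition ball_volume : \bar R :=
  lebesgue_rV R s [set x | enorm x <= 1].

(* ball_volume * (diam A / 2)^s, or +oo if diam A > delta.  Adjoining 0 to the
   supremum only matters for A = set0, and gives it gauge 0 also when s = 0. *)
Definition hausdorff_gauge (delta : R) (A : set 'rV[R]_n) : \bar R :=
  if `[< forall x y, A x -> A y -> enorm (x - y) <= delta >] then
    (ball_volume * ereal_sup (0 |`
      [set z | exists x y, [/\ A x, A y & z = ((enorm (x - y) / 2) ^+ s)%:E]]))%E
  else +oo%E.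

(* mu_ext only uses covers by Borel sets; replacing the pieces of a cover by
   their closures does not change the diameters, so this is no restriction. *)
Definition hausdorff (A : set 'rV[R]_n) : \bar R :=
  ereal_sup [set mu_ext (hausdorff_gauge delta) A | delta in [set d : R | 0 < d]].

Lemma hausdorff_gauge_ge0 delta A : (0 <= hausdorff_gauge delta A)%E.
Proof.
rewrite /hausdorff_gauge; case: ifP => // _.
by rewrite mule_ge0 ?measure_ge0//; apply: ereal_sup_ubound; left.
Qed.

Lemma hausdorff_gauge0 delta : hausdorff_gauge delta set0 = 0%E.
Proof.
rewrite /hausdorff_gauge asboolT//.
rewrite (_ : (0 |` _) = [set 0%E]) ?ereal_sup1 ?mule0//.
by apply/seteqP; split => [z [//|[x [y []]]]//|z ->]; left.
Qed.

Let hausdorff0 : hausdorff set0 = 0%E.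
Proof.
rewrite /hausdorff (_ : [set _ | _ in _] = [set 0%E]) ?ereal_sup1//.
apply/seteqP; split => [_ [d _ <-]|_ ->] /=.
  by rewrite mu_ext0// => [|?]; [exact: hausdorff_gauge0|exact: hausdorff_gauge_ge0].
exists 1 => //=.
by rewrite mu_ext0// => [|?]; [exact: hausdorff_gauge0|exact: hausdorff_gauge_ge0].
Qed.

Let hausdorff_ge0 A : (0 <= hausdorff A)%E.
Proof.
apply: (@le_trans _ _ (mu_ext (hausdorff_gauge 1) A)).
  by apply: mu_ext_ge0 => B; exact: hausdorff_gauge_ge0.
by apply: ereal_sup_ubound; exists 1 => //=.
Qed.

Let le_hausdorff : {homo hausdorff : A B / A `<=` B >-> (A <= B)%E}.
Proof.
move=> A B AB; apply: ge_ereal_sup => _ [d d0 <-].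
apply: (le_trans (le_mu_ext (hausdorff_gauge d) AB)).
by apply: ereal_sup_ubound; exists d.
Qed.

Let hausdorff_sigma_subadditive : sigma_subadditive hausdorff.
Proof.
move=> F; apply: ge_ereal_sup => _ [d d0 <-].
have g0 B : (0 <= mu_ext (hausdorff_gauge d) B)%E.
  by apply: mu_ext_ge0 => C; exact: hausdorff_gauge_ge0.
apply: (le_trans (mu_ext_sigma_subadditive (hausdorff_gauge_ge0 d) F)).
apply: lee_nneseries => // k _.
by apply: ereal_sup_ubound; exists d.
Qed.

HB.instance Definition _ := isOuterMeasure.Build R _ hausdorff
  hausdorff0 hausdorff_ge0 le_hausdorff hausdorff_sigma_subadditive.

End hausdorff.

(* The surface measure of R^n, on the sigma-algebra of H^(n-1)-measurable sets. *)
Definition surface_outer (R : realType) n :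
  {outer_measure set 'rV[R]_n -> \bar R} := @hausdorff R n n.-1.

Definition surface_type (R : realType) n := caratheodory_type (surface_outer R n).

HB.instance Definition _ (R : realType) n := Measurable.on (surface_type R n).

Definition surface (R : realType) n :
    {measure set (surface_type R n) -> \bar R} :=
  (surface_outer R n : set (caratheodory_type (surface_outer R n)) -> \bar R).

(* f is a representative of an element of L^2(D, mu). *)
Definition L2 d (T : measurableType d) (R : realType)
    (mu : {measure set T -> \bar R}) (D : set T) (f : T -> R) : Prop :=
  f \_ D \in Lfun mu 2%:E.

Section sobolev.
Variables (R : realType) (n : nat).
Implicit Types (Omega : set 'rV[R]_n) (phi u v : 'rV[R]_n -> R).
Local Notation leb := (lebesgue_rV R n).

Definition partial (i : 'I_n) phi : 'rV[R]_n -> R :=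
  fun x => 'D_(delta_mx ord0 i) phi x.

Definition smooth phi := forall (s : seq 'I_n),
  continuous (foldr partial phi s) /\
  forall i x, derivable (foldr partial phi s) x (delta_mx ord0 i).

(* C_c^oo(Omega) *)
Definition test_function Omega phi :=
  smooth phi /\ exists K : set 'rV[R]_n,
    [/\ compact K, K `<=` Omega & forall x, ~ K x -> phi x = 0].

(* u belongs to H^1(Omega) and G is (a representative of) its weak gradient. *)
Definition H1_gradient Omega u (G : 'rV[R]_n -> 'rV[R]_n) :=
  [/\ L2 leb Omega u,
      forall i, L2 leb Omega (fun x => G x ord0 i) &
      forall phi i, test_function Omega phi ->
        \int[leb]_(x in Omega) (u x * partial i phi x) =
        - \int[leb]_(x in Omega) (G x ord0 i * phi x)].

Definition H1 Omega u := exists G, H1_gradient Omega u G.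

(* Meaningful for u in H^1(Omega), and then unique almost everywhere. *)
Definition grad Omega u : 'rV[R]_n -> 'rV[R]_n := get (H1_gradient Omega u).

Definition dirichlet Omega u v : R :=
  \int[leb]_(x in Omega) (\sum_i grad Omega u x ord0 i * grad Omega v x ord0 i).

End sobolev.

Section finite_elements.
Variables (R : realType) (n : nat).
Implicit Types (Omega Gamma : set 'rV[R]_n) (T : 'M[R]_(n.+1, n)).
Implicit Types (tau : seq 'M[R]_(n.+1, n)).

(* The n.+1 rows of T are the vertices of a simplex of R^n. *)
Definition face T (I : {set 'I_n.+1}) : set 'rV[R]_n :=
  [set x | exists l : 'rV[R]_n.+1,
    [/\ forall i, 0 <= l ord0 i, forall i, i \notin I -> l ord0 i = 0,
        \sum_i l ord0 i = 1 & x = l *m T]].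

Definition simplex T : set 'rV[R]_n := face T [set: 'I_n.+1].

Definition nondegenerate T := \det (row_mx (const_mx 1 : 'cV_n.+1) T) != 0.

(* Omega = (closure Omega)^° excludes slits and punctures. *)
Definition polygonal_domain Omega :=
  [/\ open Omega, connected Omega, Omega !=set0, bounded_set Omega &
      Omega = (closure Omega)° /\
      exists tau, all nondegenerate tau /\
        closure Omega = \bigcup_(T in [set` tau]) simplex T].

Definition bdry Omega := closure Omega `\` Omega°.

(* Two elements of a triangulation meet along a (possibly empty) common face. *)
Definition triangulation Omega tau :=
  [/\ all nondegenerate tau,
      closure Omega = \bigcup_(T in [set` tau]) simplex T &
      forall T T', T \in tau -> T' \in tau -> exists I J,
        simplex T `&` simplex T' = face T I /\ face T I = face T' J].

Definition longest_side tau : R :=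
  \big[Num.max/0]_(T <- tau) \big[Num.max/0]_i \big[Num.max/0]_j
    enorm (row i T - row j T).

Definition P1 (D : set 'rV[R]_n) (v : 'rV[R]_n -> R) :=
  exists (c : R) (d : 'rV[R]_n),
    forall x, D x -> v x = c + \sum_i d ord0 i * x ord0 i.

(* Elements of C^0(closure Omega) are functions on R^n of which only the values
   on closure Omega matter. *)
Definition Kh Omega Gamma1 (b : R) tau : set ('rV[R]_n -> R) :=
  [set v : 'rV[R]_n -> R | [/\ {within closure Omega, continuous v},
      forall x, closure Omega x -> 0 <= v x,
      forall x, Gamma1 x -> v x = b &
      forall T, T \in tau -> P1 (simplex T) v]].

(* On Gamma2 the trace of a function continuous on closure Omega is its
   restriction. *)
Definition discrete_solution Omega Gamma1 Gamma2 (g q : 'rV[R]_n -> R) b tau u :=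
  Kh Omega Gamma1 b tau u /\
  forall v, Kh Omega Gamma1 b tau v ->
    dirichlet Omega u (v \- u) >=
      \int[lebesgue_rV R n]_(x in Omega) (g x * (v x - u x)) -
      \int[surface R n]_(x in Gamma2) (q x * (v x - u x)).

End finite_elements.

(* Main.v *)
Require Import Defs.
From mathcomp Require Import all_boot all_order all_algebra.
From mathcomp Require Import all_classical all_reals all_analysis.
From mathcomp Require Import measurable_realfun ring lra.

Import Order.TTheory GRing.Theory Num.Theory.
Import numFieldNormedType.Exports.

Local Open Scope classical_set_scope.
Local Open Scope ring_scope.

Set Implicit Arguments.
Unset Strict Implicit.
Unset Printing Implicit Defensive.

(* The elements of K_h restrict to the functions pw C, where C ranges over a
   closed convex set of coefficient vectors (one affine function per simplex,
   agreeing on overlaps).  Such a function is locally Lipschitz, and affine near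
   every point off the hyperplanes spanned by the facets; passing to the limit
   in difference quotients, its piecewise gradient is its weak gradient, and by
   the lemma of du Bois-Reymond it is the only one up to a null set.  Hence
   dirichlet becomes a symmetric positive semidefinite form on a
   finite-dimensional space.  It is definite on the differences of admissible
   coefficients: if the energy vanishes, the function is constant on each
   simplex, hence constant on the connected set closure Omega, and it vanishes
   on Gamma1, which has positive measure and so is nonempty.  The boundary lies
   in finitely many facets, which have finite surface measure, so the load
   functional is well defined and linear; the minimiser of the quadratic
   functional over the closed convex set is the solution. *)

(** * Continuity and linear forms *)

(** Coefficient vectors avoid any nodal basis: with one free affine function per simplex, the
    constraints defining K_h become families of linear equations and inequalities in the
    coefficients, so closedness and convexity are immediate. The price is a space E larger than the
    finite element space, on which the energy has a large kernel; hence the abstract inequality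
    keeps apart the convex set S and a closed cone W containing its differences, and asks for
    definiteness on W alone.

    The other obstacle is that [grad] is picked by [get] among all weak gradients, so [dirichlet]
    can be computed only once a weak gradient is exhibited and every other one is shown to agree
    with it almost everywhere. Exhibiting it by Green's formula on each simplex would call for
    surface integrals and normals; difference quotients call only for the translation invariance of
    [lebesgue_rV]. The comparison needs enough smooth test functions, and products of one-variable
    bumps suffice because open boxes generate the Borel sets. *)

Lemma cvg_bigsum {R : realType} {T I : Type} (F : set_system T) {FF : Filter F}
    (r : seq I) (f : I -> T -> R) (l : I -> R) :
  (forall i, f i x @[x --> F] --> l i) ->
  \sum_(i <- r) f i x @[x --> F] --> \sum_(i <- r) l i.
Proof.
move=> fl; elim: r => [|i r IH].
  by under eq_fun do rewrite big_nil; rewrite big_nil; exact: cvg_cst.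
by under eq_fun do rewrite big_cons; rewrite big_cons; exact: cvgD.
Qed.

Lemma cvg_bigprod {R : realType} {T I : Type} (F : set_system T) {FF : Filter F}
    (r : seq I) (f : I -> T -> R) (l : I -> R) :
  (forall i, f i x @[x --> F] --> l i) ->
  \prod_(i <- r) f i x @[x --> F] --> \prod_(i <- r) l i.
Proof.
move=> fl; elim: r => [|i r IH].
  by under eq_fun do rewrite big_nil; rewrite big_nil; exact: cvg_cst.
by under eq_fun do rewrite big_cons; rewrite big_cons; exact: cvgM.
Qed.

Section continuous_combinations.
Context {R : realType} {T : topologicalType}.
Implicit Types f g : T -> R.

Lemma continuous_bigsum I (r : seq I) (f : I -> T -> R) :
  (forall i, continuous (f i)) -> continuous (fun x => \sum_(i <- r) f i x).
Proof. by move=> cf x; apply: cvg_bigsum => i; exact: cf. Qed.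

Lemma continuous_mulfun f g :
  continuous f -> continuous g -> continuous (fun x => f x * g x).
Proof. by move=> cf cg x; apply: cvgM; [exact: cf|exact: cg]. Qed.

Lemma continuous_bigprod I (r : seq I) (f : I -> T -> R) :
  (forall i, continuous (f i)) -> continuous (fun x => \prod_(i <- r) f i x).
Proof. by move=> cf x; apply: cvg_bigprod => i; exact: cf. Qed.

Lemma continuous_addfun f g :
  continuous f -> continuous g -> continuous (fun x => f x + g x).
Proof. by move=> cf cg x; apply: cvgD; [exact: cf|exact: cg]. Qed.

Lemma continuous_subfun f g :
  continuous f -> continuous g -> continuous (fun x => f x - g x).
Proof. by move=> cf cg x; apply: cvgB; [exact: cf|exact: cg]. Qed.

End continuous_combinations.

Lemma bounded_by {R : realType} {V : normedModType R} (A : set V) M :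
  (forall x, A x -> `|x| <= M) -> bounded_set A.
Proof.
move=> AM; exists M; split; first exact: num_real.
by move=> N /ltW MN x /AM xM; exact: le_trans MN.
Qed.

Lemma continuous_dist {R : realType} {V : normedModType R} (y : V) :
  continuous (fun x => `|x - y|).
Proof. by move=> x; apply: cvg_norm; apply: cvgB; [exact: cvg_id|exact: cvg_cst]. Qed.

Section row_vectors.
Context {R : realType} {n : nat}.

Lemma coord_le_norm (x : 'rV[R]_n) i : `|x ord0 i| <= `|x|.
Proof.
rewrite [leRHS]mx_normrE.
exact: (le_bigmax _ (fun ij : 'I_1 * 'I_n => `|x ij.1 ij.2|) (ord0, i)).
Qed.

Lemma norm_coord_le (x : 'rV[R]_n) r :
  0 <= r -> (forall i, `|x ord0 i| <= r) -> `|x| <= r.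
Proof.
move=> r0 xr; rewrite [leLHS]mx_normrE; apply: bigmax_le => // -[i j] _ /=.
by rewrite ord1.
Qed.

Lemma linear_formE (f : 'rV[R]_n -> R) x : linear f ->
  f x = \sum_i x ord0 i * f (delta_mx ord0 i).
Proof.
move=> fl.
have fD u v : f (u + v) = f u + f v.
  by have := fl 1 u v; rewrite scale1r => ->; rewrite scale1r.
have f0 : f 0 = 0.
  have := fD 0 0; rewrite addr0 => /eqP.
  by rewrite -subr_eq0 opprD addNKr oppr_eq0 => /eqP.
have fZ k u : f (k *: u) = k * f u by have := fl k u 0; rewrite addr0 f0 addr0.
rewrite {1}[x]row_sum_delta (big_morph f fD f0).
by apply: eq_bigr => i _; rewrite fZ.
Qed.

Lemma linear_formB (f : 'rV[R]_n -> R) x y : linear f -> f (x - y) = f x - f y.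
Proof. by move=> fl; rewrite addrC -scaleN1r fl /GRing.scale/= mulN1r addrC. Qed.

Lemma linear_form_continuous (f : 'rV[R]_n -> R) : linear f -> continuous f.
Proof.
move=> fl; rewrite (_ : f = fun x => \sum_i x ord0 i * f (delta_mx ord0 i)).
  apply: continuous_bigsum => i; apply: continuous_mulfun.
    exact: coord_continuous.
  exact: cst_continuous.
by apply/funext => x; exact: linear_formE.
Qed.

Lemma linear_form_bounded (f : 'rV[R]_n -> R) : linear f ->
  exists2 M, 0 <= M & forall x, `|f x| <= M * `|x|.
Proof.
move=> fl; exists (\sum_i `|f (delta_mx ord0 i)|); first exact: sumr_ge0.
move=> x; rewrite (linear_formE x fl) mulr_suml.
apply: le_trans (ler_norm_sum _ _ _) _; apply: ler_sum => i _.
by rewrite normrM mulrC ler_wpM2l// coord_le_norm.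
Qed.

End row_vectors.

(** * Variational inequalities over a closed convex set in finite dimension *)

Section finite_dimensional_variational_inequality.
Context {R : realType} {m : nat}.
Local Notation E := 'rV[R]_m.

Variable a : E -> E -> R.
Hypothesis a_linear : forall x, linear (a x).
Hypothesis a_sym : forall x y, a x y = a y x.
Hypothesis a_ge0 : forall x, 0 <= a x x.

Let aD x y z : a x (y + z) = a x y + a x z.
Proof. by have := a_linear x 1 y z; rewrite scale1r => ->; rewrite scale1r. Qed.

Let a0 x : a x 0 = 0.
Proof. by have := aD x 0 0; rewrite addr0 => /eqP; rewrite -subr_eq0 opprD addNKr oppr_eq0 => /eqP. Qed.

Let aZ x k y : a x (k *: y) = k * a x y.
Proof. by have := a_linear x k y 0; rewrite addr0 a0 addr0. Qed.

Let a_quad_continuous : continuous (fun x => a x x).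
Proof.
have aE x : a x x = \sum_i x ord0 i *
    \sum_j x ord0 j * a (delta_mx ord0 i) (delta_mx ord0 j).
  rewrite (linear_formE x (a_linear x)); apply: eq_bigr => i _; congr (_ * _).
  by rewrite a_sym; exact: linear_formE.
rewrite (_ : (fun x => a x x) = fun x => \sum_i x ord0 i *
    \sum_j x ord0 j * a (delta_mx ord0 i) (delta_mx ord0 j)); last first.
  by apply/funext => x; exact: aE.
apply: continuous_bigsum => i; apply: continuous_mulfun; first exact: coord_continuous.
apply: continuous_bigsum => j; apply: continuous_mulfun; first exact: coord_continuous.
exact: cst_continuous.
Qed.

(** The quadratic form attains a minimum on the compact intersection of W with the unit sphere, and
    definiteness makes it positive; homogeneity carries the bound to all of W, which is stable under
    scaling. *)
Lemma coercive_on_cone (W : set E) : closed W ->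
  (forall k x, W x -> W (k *: x)) ->
  (forall x, W x -> a x x = 0 -> x = 0) ->
  exists2 lam, 0 < lam & forall x, W x -> lam * `|x| ^+ 2 <= a x x.
Proof.
move=> cW WZ Wa.
pose S1 := W `&` [set x | `|x| = 1].
have normx1 x : W x -> x != 0 -> S1 (`|x|^-1 *: x).
  move=> Wx x0; split; first exact: WZ.
  by rewrite /= normrZ normfV normr_id mulVf// normr_eq0.
have [S1n0|S10] := pselect (S1 !=set0); last first.
  (* Here W contains no nonzero vector, so any positive constant would do. *)
  exists 1 => // x Wx; have [->|x0] := eqVneq x 0.
    by rewrite normr0 expr0n mulr0.
  by exfalso; apply: S10; exists (`|x|^-1 *: x); exact: normx1.
have cS1 : compact S1.
  apply: bounded_closed_compact.
    by exists 1; split => // M M1 x [_ /= ->]; exact: ltW.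
  apply: closedI => //.
  rewrite (_ : [set x : E | `|x| = 1] = (fun x : E => `|x|) @^-1` [set 1])//.
  by apply: closed_comp => [x _|]; [exact: norm_continuous|exact: closed_eq].
have [c] := EVT_min_rV S1n0 cS1 (continuous_subspaceT a_quad_continuous).
rewrite inE => -[Wc c1] cmin.
exists (a c c).
  rewrite lt_def a_ge0 andbT; apply/eqP => /(Wa _ Wc) c0.
  by move: c1 => /=; rewrite c0 normr0 => /esym/eqP; rewrite oner_eq0.
move=> x Wx; have [->|x0] := eqVneq x 0.
  by rewrite normr0 expr0n mulr0.
have /cmin : `|x|^-1 *: x \in S1 by rewrite inE; exact: normx1.
rewrite aZ a_sym aZ mulrA -expr2 exprVn mulrC ler_pdivlMr//.
by rewrite exprn_gt0// normr_gt0.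
Qed.

(* The solution minimises J x = a x x / 2 - l x; coercivity on the differences
   y - x0 confines the minimisation to a compact set. *)
Theorem variational_inequality (l : E -> R) (S W : set E) :
  linear l -> S !=set0 -> closed S ->
  (forall x y t, S x -> S y -> 0 <= t <= 1 -> S (x + t *: (y - x))) ->
  closed W -> (forall k x, W x -> W (k *: x)) ->
  (forall x y, S x -> S y -> W (y - x)) ->
  (forall x, W x -> a x x = 0 -> x = 0) ->
  exists2 x, S x & forall y, S y -> l (y - x) <= a x (y - x).
Proof.
move=> l_linear [x0 Sx0] cS Sconv cW WZ SW Wa.
have [lam lam0 alam] := coercive_on_cone cW WZ Wa.
have lD x y : l (x + y) = l x + l y.
  by have := l_linear 1 x y; rewrite scale1r => ->; rewrite scale1r.
have l0 : l 0 = 0.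
  by have := lD 0 0; rewrite addr0 => /eqP; rewrite -subr_eq0 opprD addNKr oppr_eq0 => /eqP.
have lZ k x : l (k *: x) = k * l x.
  by have := l_linear k x 0; rewrite addr0 l0 addr0.
(* [g] is the derivative of J at [x0]; its bound M measures how fast J can decrease from there. *)
pose g y := a x0 y - l y.
have gl : linear g by move=> k u v; rewrite /g a_linear l_linear scalerBr /=; lra.
have [M M0 gM] := linear_form_bounded gl.
pose J x := 2^-1 * a x x - l x.
have JE x d : J (x + d) = J x + (a x d - l d) + 2^-1 * a d d.
  by rewrite /J aD lD [a (x + d) x]a_sym [a (x + d) d]a_sym !aD (a_sym d x); lra.
have Jc : continuous J.
  apply: continuous_subfun; last exact: linear_form_continuous.
  by apply: continuous_mulfun; [exact: cst_continuous|exact: a_quad_continuous].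
(* With N the norm of [y - x0], J exceeds [J x0] by at least [lam / 2 * N ^+ 2 - M * N], which is
   positive as soon as N is larger than this radius. *)
pose r := 2 * M / lam.
have r0 : 0 <= r by rewrite divr_ge0 ?mulr_ge0// ltW.
pose B := S `&` [set x | `|x - x0| <= r].
have cB : compact B.
  apply: bounded_closed_compact.
    apply: (@bounded_by _ _ _ (r + `|x0|)) => x [_ /= xr].
    rewrite -(subrK x0 x); apply: le_trans (ler_normD _ _) _.
    by rewrite lerD2r.
  apply: closedI => //.
  rewrite (_ : [set x | _] = (fun x : E => `|x - x0|) @^-1` [set t | t <= r])//.
  apply: closed_comp => [x _|]; last exact: closed_le.
  exact: continuous_dist.
have B0 : B !=set0 by exists x0; split => //=; rewrite subrr normr0.
have [u] := EVT_min_rV B0 cB (continuous_subspaceT Jc).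
rewrite inE => -[Su ur] umin.
have Jmin y : S y -> J u <= J y.
  move=> Sy; have [yr|yr] := leP (`|y - x0|) r.
    by apply: umin; rewrite inE.
  have : J u <= J x0 by apply: umin; rewrite inE; split => //=; rewrite subrr normr0.
  move=> /le_trans; apply; have -> : y = x0 + (y - x0) by rewrite addrC subrK.
  rewrite JE -addrA lerDl.
  have := alam _ (SW _ _ Sx0 Sy); have := gM (y - x0); rewrite /g ler_norml.
  move: yr; rewrite /r ltr_pdivrMr// mulrC => yr /andP[+ _].
  move: (a x0 _ - _) (a (y - x0) _) `|y - x0| (normr_ge0 (y - x0)) yr => p q N.
  by move=> N0 NM pN qN; have := ler_wpM2l N0 (ltW NM); nra.
exists u => // y Sy; set d := y - u.
rewrite -subr_ge0 leNgt; apply/negP => neg.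
pose p := a u d - l d.
have Jt t : 0 <= t <= 1 -> 0 <= t * p + 2^-1 * (t ^+ 2 * a d d).
  move=> t01; have := Jmin _ (Sconv _ _ _ Su Sy t01).
  by rewrite JE !aZ lZ (a_sym (t *: _)) aZ -/d -addrA lerDl /p; nra.
have p0 : p < 0 by [].
have q0 := a_ge0 d.
(* This t gives [t * a d d <= - p], so the quadratic in [Jt] is at most [t * p / 2 < 0]. The added 1
   keeps the denominator positive when [a d d] vanishes. *)
pose t := Num.min 1 (- p / (a d d + 1)).
have q1 : 0 < a d d + 1 by rewrite ltr_pwDr.
have t0 : 0 < t by rewrite /t lt_min ltr01 divr_gt0// oppr_gt0.
have t1 : t <= 1 by rewrite /t ge_min lexx.
have tp : t * (a d d + 1) <= - p.
  by rewrite -ler_pdivlMr// /t ge_min lexx orbT.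
have := Jt t; rewrite t1 (ltW t0) => /(_ isT); nra.
Qed.

End finite_dimensional_variational_inequality.

(** * Lebesgue measure on R^n *)

Section borel_boxes.
Context {R : realType} {n : nat}.

Definition box (A : 'I_n -> set R) : set 'rV[R]_n :=
  [set x | forall i, A i (x ord0 i)].

Definition open_box (a b : 'I_n -> R) := box (fun i => `]a i, b i[%classic).

Lemma open_boxI (a b c d : 'I_n -> R) :
  open_box a b `&` open_box c d =
  open_box (fun i => Num.max (a i) (c i)) (fun i => Num.min (b i) (d i)).
Proof.
apply/seteqP; split => [x [xab xcd] i|x xm].
  have := xab i; have := xcd i; rewrite /= !in_itv/= gt_max lt_min.
  by move=> /andP[-> ->] /andP[-> ->].
split => i; have := xm i; rewrite /= !in_itv/= gt_max lt_min;
  by move=> /andP[/andP[? ?] /andP[? ?]]; apply/andP.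
Qed.

Lemma open_box_setI_closed :
  setI_closed [set B : set 'rV[R]_n | exists a b, B = open_box a b].
Proof. by move=> _ _ [a [b ->]] [c [d ->]]; rewrite open_boxI; do 2 eexists. Qed.

Lemma measurable_box (A : 'I_n -> set R) :
  (forall i, measurable (A i)) -> measurable (box A).
Proof.
move=> mA; rewrite (_ : box A =
    \bigcap_(i in [set: 'I_n]) ((fun x : 'rV[R]_n => x ord0 i) @^-1` A i)).
  apply: fin_bigcap_measurable => // i _; rewrite -[X in measurable X]setTI.
  exact: measurable_coord.
by apply/seteqP; split => x Ax i; [move=> _|]; exact: Ax.
Qed.

Lemma bigcup_open_box_sym :
  \bigcup_k open_box (fun=> - k%:R) (fun=> k%:R) = [set: 'rV[R]_n].
Proof.
apply/seteqP; split => // x _; exists (Num.truncn (`|x|)).+1 => //= i.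
rewrite /= in_itv/= -ltr_norml; apply: le_lt_trans (truncnS_gt `|x|).
exact: coord_le_norm.
Qed.

(** A coordinate half-space is the countable union of open boxes whose other sides grow to infinity.
    Boxes being stable under intersection, this gives access to uniqueness of measures and to
    Dynkin's induction. *)
Lemma measurable_rVE : @measurable _ 'rV[R]_n =
  <<s [set B | exists a b, B = open_box a b] >>.
Proof.
apply/seteqP; split; last first.
  apply: smallest_sub; first exact: sigma_algebra_measurable.
  by move=> _ [a [b ->]]; exact: measurable_box.
apply: smallest_sub; first exact: smallest_sigma_algebra.
move=> B; rewrite -bigcup_seq => -[/= i _] pB.
have : preimage_set_system setT (fun x : 'rV[R]_n => x ord0 i)
    (@RGenOInfty.G R).-sigma.-measurable B.
  by case: pB => Y mY <-; exists Y => //; rewrite -RGenOInfty.measurableE.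
rewrite -g_sigma_preimageE; apply: smallest_sub.
  exact: smallest_sigma_algebra.
move=> _ [_ [x ->] <-]; rewrite setTI.
rewrite (_ : _ @^-1` _ = \bigcup_k
    open_box (fun j => if j == i then x else - k%:R) (fun=> k%:R)).
  have [_ _ +] := smallest_sigma_algebra [set: 'rV[R]_n]
    [set B | exists a b, B = open_box a b].
  by apply => k; apply: sub_sigma_algebra; eexists; eexists.
apply/seteqP; split => [y|y [k _ /(_ i)]]/=; rewrite ?in_itv/= ?andbT.
  move=> xy; have : [set: 'rV[R]_n] y by [].
  rewrite -bigcup_open_box_sym => -[k _ yk]; exists k => //= j.
  by have := yk j; rewrite /= !in_itv/=; case: eqP => // -> /andP[_ ->]; rewrite xy.
by rewrite eqxx => /andP[].
Qed.

Lemma measure_rV_unique (m1 m2 : {measure set 'rV[R]_n -> \bar R}) :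
  (forall a b, m1 (open_box a b) = m2 (open_box a b)) ->
  (forall k : nat, m1 (open_box (fun=> - k%:R)%R (fun=> k%:R)%R) < +oo)%E ->
  forall A, measurable A -> m1 A = m2 A.
Proof.
move=> m12 m1oo A mA.
apply: (@measure_unique _ R 'rV[R]_n [set B | exists a b, B = open_box a b]
  (fun k => open_box (fun=> - k%:R) (fun=> k%:R))) => //.
- exact: measurable_rVE.
- exact: open_box_setI_closed.
- by move=> k; do 2 eexists.
- exact: bigcup_open_box_sym.
- by move=> _ [a [b ->]].
Qed.

Lemma ball_open_box (x : 'rV[R]_n) r : 0 < r ->
  ball x r = open_box (fun i => x ord0 i - r) (fun i => x ord0 i + r).
Proof.
move=> r0; apply/seteqP; split => [y [_ xy] i|y xy].
  have := xy ord0 i; rewrite /ball/= in_itv/= ltr_norml.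
  by move=> /andP[? ?]; apply/andP; split; lra.
split => // i j; rewrite ord1; have := xy j; rewrite /ball/= in_itv/= ltr_norml.
by move=> /andP[? ?]; apply/andP; split; lra.
Qed.

(** Rational centres and radii [1 / (k + 1)] make the index set countable. The closed balls are
    required to lie in U, so that the closed boxes supporting the bumps still fit inside. *)
Lemma open_rat_balls (U : set 'rV[R]_n) : open U ->
  U = \bigcup_(p in [set p : 'rV[rat]_n * nat |
        [set y | `|map_mx ratr p.1 - y| <= p.2.+1%:R^-1] `<=` U])
      ball (map_mx ratr p.1 : 'rV[R]_n) p.2.+1%:R^-1.
Proof.
move=> oU; apply/seteqP; split => [x Ux|x [p /= pU xp]]; last first.
  by apply: pU; move: xp; rewrite -ball_normE/= => /ltW.
have /nbhs_ballP[e /= e0 xeU] : nbhs x U by exact: open_nbhs_nbhs.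
pose k := Num.truncn (2 / e).
have ke : k.+1%:R^-1 < e / 2.
  rewrite -[e / 2]invf_div ltf_pV2 ?posrE ?divr_gt0 ?ltr0n//.
  exact: truncnS_gt.
have k0 : (0 : R) < k.+1%:R^-1 by rewrite invr_gt0 ltr0n.
have /choice[q qx] : forall i : 'I_n, exists q : rat,
    ratr q \in `]x ord0 i - k.+1%:R^-1, x ord0 i + k.+1%:R^-1[.
  by move=> i; apply: rat_in_itvoo; rewrite ltrBlDr -addrA ltrDl addr_gt0.
pose c : 'rV[R]_n := map_mx ratr (\row_i q i).
have xc : `|x - c| < e / 2.
  apply: le_lt_trans ke; apply: norm_coord_le => [|i]; first exact: ltW.
  have := qx i; rewrite in_itv/= !mxE ler_norml.
  by move: (k.+1%:R^-1) => r /andP[? ?]; apply/andP; split; lra.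
exists (\row_i q i, k) => /=.
  apply: subset_trans xeU => y /= cy; rewrite -ball_normE/=.
  apply: le_lt_trans (ler_distD c x y) _.
  by rewrite (splitr e) ltrD// (le_lt_trans cy).
rewrite ball_open_box// => i; have := qx i.
rewrite /= !in_itv/= !mxE; move: (k.+1%:R^-1) => r /andP[? ?].
by apply/andP; split; lra.
Qed.

Lemma open_measurable_rV (U : set 'rV[R]_n) : open U -> measurable U.
Proof.
move=> /open_rat_balls ->; rewrite bigcup_mkcond.
apply: countable_bigcupT_measurable => [|p]; first exact: countableP.
case: ifPn => // _; rewrite ball_open_box ?invr_gt0 ?ltr0n//.
exact: measurable_box.
Qed.

Lemma closed_measurable_rV (F : set 'rV[R]_n) : closed F -> measurable F.
Proof.
by move=> cF; rewrite -[F]setCK; apply: measurableC; apply: open_measurable_rV;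
  exact: closed_openC.
Qed.

Lemma continuous_measurable_rV (f : 'rV[R]_n -> R) :
  continuous f -> measurable_fun [set: 'rV[R]_n] f.
Proof.
move=> cf.
apply: (@measurability _ _ _ _ _ _ (@RGenOInfty.G R)).
  exact: RGenOInfty.measurableE.
move=> _ [_ [x ->] <-]; rewrite setTI; apply: open_measurable_rV.
by apply: open_comp => [y _|]; [exact: cf|exact: rray_open].
Qed.

End borel_boxes.

Section lebesgue_rV_properties.
Context {R : realType}.
Local Notation leb := (lebesgue_rV R).

Lemma lebesgue_rV_S n (A : set 'rV[R]_n.+1) :
  leb n.+1 A = (lebesgue_measure \x leb n)%E (@cons_rV R n @^-1` A).
Proof. by []. Qed.

Lemma lebesgue_box n (A : 'I_n -> set R) : (forall i, measurable (A i)) ->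
  leb n (box A) = (\prod_(i < n) lebesgue_measure (A i))%E.
Proof.
elim: n A => [|n IH] A mA.
  by rewrite big_ord0 /= diracE mem_set// => -[].
rewrite lebesgue_rV_S big_ord_recl -IH//.
have mA' : measurable (box (fun i => A (lift ord0 i))) by exact: measurable_box.
rewrite -(product_measure1E lebesgue_measure (leb n) (mA ord0) mA').
congr (_ _); apply/seteqP; split => [[x y] xyA|[x y] [xA yA] i] /=.
  split => [|i]; first by have := xyA ord0; rewrite cons_rV0.
  by have := xyA (lift ord0 i); rewrite cons_rVS.
by case: (unliftP ord0 i) => [j ->|->]; rewrite (cons_rVS, cons_rV0)//; exact: yA.
Qed.

Lemma lebesgue_open_box n (a b : 'I_n -> R) : (forall i, a i <= b i) ->
  leb n (open_box a b) = (\prod_(i < n) (b i - a i))%:E.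
Proof.
move=> ab; rewrite lebesgue_box//.
elim/big_ind2 : _ => [//|x1 x2 y1 y2 -> ->//|i _].
by rewrite lebesgue_measure_itv/= lte_fin; case: ltgtP (ab i) => // ->; rewrite subrr.
Qed.

Lemma open_box0 n (a b : 'I_n -> R) i : b i <= a i -> open_box a b = set0.
Proof.
move=> ba; apply/seteqP; split => // x /(_ i)/=; rewrite in_itv/=.
by move=> /andP[/lt_trans h /h]; rewrite ltNge ba.
Qed.

Lemma lebesgue_rV_bounded n (A : set 'rV[R]_n) : measurable A ->
  bounded_set A -> (leb n A < +oo)%E.
Proof.
move=> mA [M [_ /(_ (`|M| + 1))]]; rewrite ltr_pwDr ?ler_norm// => /(_ isT) AM.
apply: (@le_lt_trans _ _ (leb n (open_box (fun=> - (`|M| + 2)) (fun=> `|M| + 2)))).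
  apply: le_measure; rewrite ?inE//; first exact: measurable_box.
  move=> x /AM/= xM i; rewrite /= in_itv/= -ltr_norml.
  by apply: le_lt_trans (coord_le_norm x i) _; apply: (le_lt_trans xM); rewrite ltrD2l ltrDl.
by rewrite lebesgue_open_box ?ltry// => i; have := normr_ge0 M; lra.
Qed.

Lemma lebesgue_rV_open_gt0 n (U : set 'rV[R]_n) : open U -> U !=set0 ->
  (0 < leb n U)%E.
Proof.
move=> oU [x Ux].
have /nbhs_ballP[e /= e0 xeU] : nbhs x U by exact: open_nbhs_nbhs.
have mb : measurable (ball x e) by apply: open_measurable_rV; exact: ball_open.
apply: (@lt_le_trans _ _ (leb n (ball x e))); last first.
  by apply: le_measure; rewrite ?inE//; exact: open_measurable_rV.
rewrite ball_open_box// lebesgue_open_box => [|i]; last by lra.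
by rewrite lte_fin; apply: prodr_gt0 => i _; lra.
Qed.

(** By uniqueness it suffices to compare open boxes, whose sides keep their lengths when shifted;
    boxes with an empty side are treated apart because the volume formula requires [a i <= b i]. *)
Lemma lebesgue_rV_translation n (v : 'rV[R]_n) (A : set 'rV[R]_n) :
  measurable A -> pushforward (leb n) (+%R^~ v) A = leb n A.
Proof.
have mv : measurable_fun [set: 'rV[R]_n] (+%R^~ v).
  apply: measurable_fun_rV => i; under eq_fun do rewrite mxE.
  by apply: measurable_funD => //; exact: measurable_coord.
move=> mA; apply/esym.
apply: (measure_rV_unique (m1 := leb n) (m2 := pushforward (leb n) (+%R^~ v))) => //.
  move=> a b.
  transitivity (leb n (open_box (fun i => a i - v ord0 i) (fun i => b i - v ord0 i)));
    last first.
    congr (leb n _); apply/seteqP; split => x xab i; have := xab i;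
    rewrite /= !in_itv/= !mxE => /andP[? ?]; apply/andP; split; lra.
  have [ab|/existsNP[i /negP]] := pselect (forall i, a i <= b i).
    rewrite [LHS]lebesgue_open_box// [RHS]lebesgue_open_box; last by move=> i; rewrite lerB.
    by congr _%:E; apply: eq_bigr => i _; lra.
  rewrite -ltNge => /ltW ba.
  by rewrite !(@open_box0 _ _ _ i)// lerB.
move=> k; apply: lebesgue_rV_bounded; first exact: measurable_box.
exists k%:R; split => // M kM x xk; apply: norm_coord_le.
  by apply: ltW; apply: le_lt_trans kM.
by move=> i; have := xk i; rewrite /= in_itv/= -ltr_norml => /lt_trans/(_ kM)/ltW.
Qed.

(** Induction on the dimension by Fubini. If a coefficient other than the first is nonzero, every
    slice is null by induction; if only the first one is, the set is a point times R^n. The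
    alternative [c != 0] covers an equation without variables, whose solution set is empty. *)
Lemma lebesgue_hyperplane n (c : R) (l : 'I_n -> R) :
  c != 0 \/ (exists i, l i != 0) ->
  leb n [set x | c + \sum_i l i * x ord0 i = 0] = 0%E.
Proof.
have mh m (c' : R) (l' : 'I_m -> R) :
    measurable [set x : 'rV[R]_m | c' + \sum_i l' i * x ord0 i = 0].
  rewrite (_ : [set _ | _] =
    (fun x : 'rV[R]_m => c' + \sum_i l' i * x ord0 i) @^-1` [set 0])//.
  rewrite -[X in measurable X]setTI.
  suff : measurable_fun setT (fun x : 'rV[R]_m => c' + \sum_i l' i * x ord0 i).
    exact.
  apply: measurable_funD => //; apply: measurable_sum => i.
  by apply: measurable_funM => //; exact: measurable_coord.
elim: n c l => [|n IH] c l.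
  move=> [c0|[[]//]]; rewrite (_ : [set _ | _] = set0) ?measure0//.
  by apply/seteqP; split => // x /=; rewrite big_ord0 addr0; exact/eqP.
move=> cl; transitivity ((lebesgue_measure \x leb n)%E
    [set x : R * 'rV[R]_n | (c + l ord0 * x.1) + \sum_i l (lift ord0 i) * x.2 ord0 i = 0]).
  rewrite lebesgue_rV_S; congr (product_measure1 _ _ _).
  have E x : c + \sum_i l i * cons_rV x ord0 i =
      c + l ord0 * x.1 + \sum_i l (lift ord0 i) * x.2 ord0 i.
    rewrite big_ord_recl cons_rV0 addrA; congr (_ + _).
    by apply: eq_bigr => i _; rewrite cons_rVS.
  by apply/seteqP; split => x /=; rewrite E.
have [l0|l0] := pselect (exists i, l (lift ord0 i) != 0).
  rewrite /product_measure1.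
  apply: integral0_eq => x _; rewrite /= xsectionE.
  exact: (IH (c + l ord0 * (x : R)) (fun i => l (lift ord0 i)) (or_intror l0)).
have {}l0 i : l (lift ord0 i) = 0.
  by apply/eqP; apply: contrapT => /negP h; apply: l0; exists i.
have [/eqP l00|l00] := boolP (l ord0 == 0).
  have c0 : c != 0.
    case: cl => // -[i]; case: (unliftP ord0 i) => [j ->|->]; first by rewrite l0 eqxx.
    by rewrite l00 eqxx.
  rewrite /product_measure1; apply: integral0_eq => x _; rewrite /= xsectionE.
  rewrite (_ : _ @^-1` _ = set0) ?measure0//; apply/seteqP; split => // y /=.
  rewrite l00 mul0r addr0 big1 ?addr0; first exact/eqP.
  by move=> i _; rewrite l0 mul0r.
rewrite (_ : [set _ | _] = [set - c / l ord0] `*` [set: 'rV[R]_n]).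
  have := product_measure1E lebesgue_measure (leb n)
    (measurable_set1 (- c / l ord0)) (@measurableT _ 'rV[R]_n).
  move=> ->; rewrite [X in (X * _)%E](_ : _ = 0%E) ?mul0e//.
  exact: (lebesgue_measure_set1 (- c / l ord0)).
apply/seteqP; split => [[x y]|[x y] [/= -> _]] /=; rewrite big1 ?addr0.
  move=> /eqP; rewrite addrC addr_eq0 => /eqP cx; split => //.
  by rewrite -cx mulrAC mulfV// mul1r.
  by move=> i _; rewrite l0 mul0r.
  by field.
by move=> i _; rewrite l0 mul0r.
Qed.

End lebesgue_rV_properties.

(** * Smooth bump functions and the lemma of du Bois-Reymond *)

Section flat_exponential.
Context {R : realType}.

(* exp(-c/x), extended by 0 to x <= 0, together with the factors x^(-k) that
   its derivatives involve. *)
Definition flat_exp (c : R) (k : nat) (x : R) : R :=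
  if 0 < x then x^-1 ^+ k * expR (- (c * x^-1)) else 0.

(** The exponential dominates each term of its series: [(c * y) ^+ k / k!] is at most
    [expR (c * y)]. *)
Lemma pow_expRN_bounded (c : R) (k : nat) : 0 < c ->
  exists2 M, 0 <= M & forall y, 0 <= y -> y ^+ k * expR (- (c * y)) <= M.
Proof.
move=> c0; exists (k`!%:R / c ^+ k + 1) => [|y y0].
  by rewrite addr_ge0// divr_ge0// exprn_ge0// ltW.
rewrite expRN ler_pdivrMr ?expR_gt0//.
have cy0 : 0 <= c * y by rewrite mulr_ge0// ltW.
case: k => [|k].
  have : 1 <= expR (c * y) by rewrite -expR0 ler_expR.
  by rewrite fact0 !expr0 divr1; lra.
have e1 := expR_ge1Dxn k cy0.
apply: (@le_trans _ _ (k.+1`!%:R / c ^+ k.+1 * expR (c * y))); last first.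
  by rewrite ler_wpM2r ?expR_ge0// lerDl.
apply: (@le_trans _ _ (k.+1`!%:R / c ^+ k.+1 * ((c * y) ^+ k.+1 / k.+1`!%:R))).
  rewrite exprMn le_eqVlt; apply/orP; left; apply/eqP; field.
  by rewrite gt_eqF//= expf_neq0// ?gt_eqF// pnatr_eq0 -lt0n fact_gt0.
rewrite ler_wpM2l ?divr_ge0 ?exprn_ge0 ?(ltW c0)//.
by apply: le_trans e1; rewrite lerDr.
Qed.

(** The derivative is again a combination of members of the family, so differentiation can be
    iterated. At 0 the quotient is h times [h ^- (k + 2) * expR (- c / h)] for h > 0, hence at most
    [h * M]. *)
Lemma is_derive_flat_exp (c : R) (k : nat) (x : R) : 0 < c ->
  is_derive x 1 (flat_exp c k)
    (c * flat_exp c k.+2 x - k%:R * flat_exp c k.+1 x).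
Proof.
move=> c0; have [x0|x0|<-] := ltgtP 0 x.
- apply: (@near_eq_is_derive R R^o R^o
    (fun y : R => y^-1 ^+ k * expR (- (c * y^-1)))).
    near=> y; rewrite /flat_exp ifT//; near: y; exact: lt_nbhsr.
  have x0' : (id : R -> R) x != 0 by rewrite gt_eqF.
  have dV : is_derive x (1 : R) (fun y : R => y^-1) (- x ^- 2).
    apply: DeriveDef; first by apply: derivableV => //; exact: derivable_id.
    have did : derivable (id : R -> R) x 1 by exact: derivable_id.
    by rewrite (deriveV x0' did) derive_id /GRing.scale/= mulr1.
  have dp : is_derive x 1 (fun y => y^-1 ^+ k) (k%:R * x^-1 ^+ k.-1 * (- x ^- 2)).
    rewrite (_ : (fun y : R => _) = (fun y : R => y^-1) ^+ k); first exact: is_deriveX.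
    by rewrite exprfctE.
  have de : is_derive x 1 (fun y => expR (- (c * y^-1)))
      (expR (- (c * x^-1)) * (- (c * (- x ^- 2)))).
    have dn := is_deriveN (is_deriveZ c dV).
    exact: (@is_derive1_comp _ expR _ _ _ _ (is_derive_expR _) dn).
  have dm := is_deriveM dp de; apply: (is_derive_eq dm).
  rewrite /flat_exp x0 /GRing.scale/=; case: k {dp dm} => [|k] /=; rewrite ?exprS ?expr0; by field.
- apply: (@near_eq_is_derive R R^o R^o (cst 0)).
    near=> y; rewrite /flat_exp ifF//=; apply/negbTE; rewrite -leNgt ltW//.
    near: y; exact: lt_nbhsl.
  by rewrite /flat_exp ltNge (ltW x0)/= !mulr0 subr0; exact: is_derive_cst.
rewrite /flat_exp ltxx !mulr0 subr0.
have [M M0 Mb] := pow_expRN_bounded k.+2 c0.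
have d0 : (fun h => h^-1 *: (flat_exp c k (h *: (1 : R) + 0) - flat_exp c k 0)) @ 0^' --> (0 : R).
  apply/cvgrPdist_le => e e0; near=> h.
  rewrite sub0r normrN addr0 /flat_exp ltxx subr0 /GRing.scale/= mulr1.
  case: ifPn => h0; last by rewrite mulr0 normr0 ltW.
  rewrite ger0_norm; last by rewrite !mulr_ge0 ?expR_ge0// ?exprn_ge0// invr_ge0 ltW.
  have hM : h * M <= e.
    rewrite (le_trans (ler_wpM2l (ltW h0) (_ : M <= M + 1)))// ?lerDl//.
    rewrite -ler_pdivlMr ?ltr_wpDl//.
    by apply: le_trans (ler_norm _) _; near: h; apply: dnbhs0_le; rewrite divr_gt0// ltr_wpDl.
  apply: le_trans hM; have := ler_wpM2l (ltW h0) (Mb h^-1 _).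
  rewrite invr_ge0 (ltW h0) => /(_ isT); apply: le_trans.
  by rewrite exprS !mulrA mulfV ?gt_eqF// mul1r exprS -mulrA.
by apply: DeriveDef; [exact: cvgP d0|exact: cvg_lim d0].
Unshelve. all: by end_near. Qed.

End flat_exponential.

Section smooth_real_functions.
Context {R : realType}.
Implicit Types f g : R -> R.

(** Counting the derivatives lets stability under linear combinations, products and affine
    substitutions go by induction on the count; C^oo means [csmooth m f] for all m. *)
Fixpoint csmooth (m : nat) f : Prop :=
  if m is m'.+1 then (forall x, derivable f x 1) /\ csmooth m' (derive1 f) else True.

Lemma csmoothS m f f' : (forall x : R, is_derive x 1 f (f' x)) -> csmooth m f' ->
  csmooth m.+1 f.
Proof.
move=> df sf'; split => [x|]; first by case: (df x).
rewrite (_ : (derive1 f) = f')//; apply/funext => x; rewrite derive1E.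
by case: (df x).
Qed.

Lemma csmooth_is_derive m f (x : R) : csmooth m.+1 f -> is_derive x 1 f ((derive1 f) x).
Proof. by move=> [df _]; apply: DeriveDef; rewrite ?derive1E. Qed.

Lemma csmoothW m f : csmooth m.+1 f -> csmooth m f.
Proof. by elim: m f => // m IH f [df /IH]. Qed.

Lemma csmooth_lin m f g (a b : R) : csmooth m f -> csmooth m g ->
  csmooth m (fun x => a * f x + b * g x).
Proof.
elim: m f g => // m IH f g sf sg.
apply: (@csmoothS _ _ (fun x => a * (derive1 f) x + b * (derive1 g) x)).
  move=> x; apply: is_deriveD.
    exact: (is_deriveZ a (csmooth_is_derive x sf)).
  exact: (is_deriveZ b (csmooth_is_derive x sg)).
by apply: IH; [exact: sf.2|exact: sg.2].
Qed.

Lemma csmoothM m f g : csmooth m f -> csmooth m g -> csmooth m (fun x => f x * g x).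
Proof.
elim: m f g => // m IH f g sf sg.
apply: (@csmoothS _ _ (fun x => 1 * (f x * (derive1 g) x) + 1 * (g x * (derive1 f) x))).
  move=> x; rewrite !mul1r.
  exact: (is_deriveM (csmooth_is_derive x sf) (csmooth_is_derive x sg)).
by apply: csmooth_lin; apply: IH; by [exact: sf.2|exact: sg.2|exact: csmoothW].
Qed.

Lemma csmooth_affine m f (a b : R) : csmooth m f -> csmooth m (fun x => f (a * x + b)).
Proof.
elim: m f => // m IH f sf.
apply: (@csmoothS _ _ (fun x => a * (derive1 f) (a * x + b) + 0 * (derive1 f) (a * x + b))).
  move=> x; rewrite mul0r addr0 mulrC.
  apply: (@is_derive1_comp _ f (fun x => a * x + b)).
    exact: (csmooth_is_derive _ sf).
  rewrite -[X in is_derive _ _ _ X]addr0 -[X in is_derive _ _ _ (X + _)]mulr1.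
  exact: (is_deriveD (is_deriveZ a (is_derive_id x 1)) (is_derive_cst b x 1)).
by apply: csmooth_lin; apply: IH; exact: sf.2.
Qed.

Lemma csmooth_flat_exp m c k : 0 < c -> csmooth m (@flat_exp R c k).
Proof.
move=> c0; elim: m k => // m IH k.
apply: (@csmoothS _ _ (fun x => c * flat_exp c k.+2 x + - k%:R * flat_exp c k.+1 x)).
  by move=> x; rewrite mulNr; exact: is_derive_flat_exp.
exact: csmooth_lin.
Qed.

(** The parameter c is meant to tend to 0: the bumps stay between 0 and 1, vanish outside ]a, b[,
    and converge pointwise to its indicator. *)
Definition bump (a b c x : R) : R := flat_exp c 0 (x - a) * flat_exp c 0 (b - x).

Lemma csmooth_bump m a b c : 0 < c -> csmooth m (bump a b c).
Proof.
move=> c0; apply: csmoothM.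
  have := csmooth_affine 1 (- a) (csmooth_flat_exp m 0 c0).
  by under eq_fun do rewrite mul1r.
have := csmooth_affine (-1) b (csmooth_flat_exp m 0 c0).
by under eq_fun do rewrite mulN1r addrC.
Qed.

Lemma flat_exp0_itv c x : 0 < c -> 0 <= (flat_exp c 0 x : R) <= 1.
Proof.
move=> c0; rewrite /flat_exp; case: ifP => x0; last by rewrite lexx ler01.
by rewrite expr0 mul1r expR_ge0 expR_le1 oppr_le0 mulr_ge0// ?invr_ge0 ltW.
Qed.

Lemma bump_itv a b c x : 0 < c -> 0 <= bump a b c x <= 1.
Proof.
move=> c0; have /andP[h1 h2] := flat_exp0_itv (x - a) c0.
have /andP[h3 h4] := flat_exp0_itv (b - x) c0.
by rewrite /bump mulr_ge0// mulr_ile1.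
Qed.

Lemma bump_out a b c x : ~~ (a < x < b) -> bump a b c x = 0.
Proof.
rewrite /bump /flat_exp !subr_gt0; case: ltP => _; case: ltP => _ //=;
by rewrite ?mul0r ?mulr0.
Qed.

Lemma bump_cvg a b x : bump a b k.+1%:R^-1 x @[k --> \oo] -->
  (if a < x < b then 1 else 0 : R).
Proof.
have flat_cvg (y : R) : 0 < y -> flat_exp k.+1%:R^-1 0 y @[k --> \oo] --> (1 : R).
  move=> y0; rewrite /flat_exp y0; under eq_fun do rewrite expr0 mul1r.
  have h : - (k.+1%:R^-1 / y) @[k --> \oo] --> (0 : R).
    rewrite -oppr0; apply: cvgN; rewrite -(mul0r y^-1); apply: cvgMr_tmp.
    exact: cvg_harmonic.
  have := @continuous_cvg _ _ _ _ _ _ expR 0 (@continuous_expR R 0) h.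
  by rewrite expR0 => /(_ eventually_filter).
case: ifPn => [/andP[ax xb]|out].
  rewrite -[X in _ --> X](mulr1 1); apply: cvgM; apply: flat_cvg; by rewrite subr_gt0.
by under eq_fun do rewrite bump_out//; exact: cvg_cst.
Qed.

End smooth_real_functions.

Section test_functions.
Context {R : realType} {n : nat}.
Implicit Types f : 'I_n -> R -> R.
Local Notation leb := (lebesgue_rV R n).

Definition prodf f (x : 'rV[R]_n) := \prod_i f i (x ord0 i).

Lemma is_derive_prodf f i (x : 'rV[R]_n) d : is_derive (x ord0 i) (1 : R) (f i) d ->
  is_derive x (delta_mx ord0 i) (prodf f)
    ((\prod_(j | j != i) f j (x ord0 j)) * d).
Proof.
move=> [df dE].
have fE : prodf f x = (\prod_(j | j != i) f j (x ord0 j)) * f i (x ord0 i).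
  by rewrite /prodf (bigD1 i)//= mulrC.
have fhE h : prodf f (h *: delta_mx ord0 i + x) =
    (\prod_(j | j != i) f j (x ord0 j)) * f i (h *: (1 : R) + x ord0 i).
  rewrite /prodf (bigD1 i)//= mulrC; congr (_ * _); last by rewrite !mxE !eqxx.
  by apply: eq_bigr => j ji; rewrite !mxE eqxx (negbTE ji) mulr0 add0r.
have cvgf : (fun h => h^-1 *: ((prodf f \o shift x) (h *: delta_mx ord0 i) - prodf f x))
    @ 0^' --> (\prod_(j | j != i) f j (x ord0 j)) * d.
  rewrite [X in X @ _ --> _](_ : _ = (fun h => (\prod_(j | j != i) f j (x ord0 j)) *
      (h^-1 *: ((f i \o shift (x ord0 i)) (h *: (1 : R)) - f i (x ord0 i))))).
    by apply: cvgMl_tmp; rewrite -dE; exact: df.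
  by apply/funext => h; rewrite /= fhE fE -mulrBr /GRing.scale/= mulrCA.
by apply: DeriveDef; [exact: cvgP cvgf|exact: cvg_lim cvgf].
Qed.

Lemma csmooth_continuous (g : R -> R) : csmooth 1 g -> continuous g.
Proof.
by move=> [dg _] x; apply: differentiable_continuous; exact/derivable1_diffP.
Qed.

(** A partial derivative of a product of one-variable functions is a product of the same kind with
    one factor differentiated, so all iterated partials are covered by a single form. *)
Lemma smooth_prodf f : (forall i m, csmooth m (f i)) -> smooth (prodf f).
Proof.
move=> sf s.
have [g sg ->] : exists2 g : 'I_n -> R -> R, (forall i m, csmooth m (g i)) &
    foldr (@partial R n) (prodf f) s = prodf g.
  elim: s => [|i s [g sg gE]]; first by exists f.
  exists (fun j => if j == i then derive1 (g i) else g j).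
    by move=> j m; case: eqP => _ //; exact: (sg i m.+1).2.
  apply/funext => x; rewrite /= gE /partial.
  have [_ ->] := is_derive_prodf (csmooth_is_derive (x ord0 i) (sg i 1)).
  rewrite [RHS](bigD1 i)//= eqxx mulrC; congr (_ * _).
  by apply: eq_bigr => j /negbTE ->.
split=> [|i x].
  apply: continuous_bigprod => i x.
  apply: (@continuous_comp _ _ _ (fun x : 'rV[R]_n => x ord0 i) (g i)).
    exact: coord_continuous.
  exact: (csmooth_continuous (sg i 1)).
by have [] := is_derive_prodf (csmooth_is_derive (x ord0 i) (sg i 1)).
Qed.

Definition closed_box (a b : 'I_n -> R) := box (fun i => `[a i, b i]%classic).

Lemma test_function_bump (Omega : set 'rV[R]_n) a b c : 0 < c ->
  closed_box a b `<=` Omega ->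
  test_function Omega (prodf (fun i => bump (a i) (b i) c)).
Proof.
move=> c0 abO; split; first by apply: smooth_prodf => i m; exact: csmooth_bump.
exists (closed_box a b); split=> //.
  by apply: rV_compact => i; exact: segment_compact.
move=> x /existsNP[i /negP xi]; rewrite /prodf (bigD1 i)//= bump_out ?mul0r//.
by apply: contra xi; rewrite in_itv/= => /andP[/ltW -> /ltW ->].
Qed.

Lemma measurable_prodf_bump a b c : 0 < c ->
  measurable_fun [set: 'rV[R]_n] (prodf (fun i => bump (a i) (b i) c)).
Proof.
move=> c0; apply: continuous_measurable_rV.
by have [] := @smooth_prodf (fun i => bump (a i) (b i) c)
  (fun i m => csmooth_bump m (a i) (b i) c0) [::].
Qed.

Section du_bois_reymond.
Variables (Omega : set 'rV[R]_n) (N : 'rV[R]_n -> R).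
Hypothesis oOmega : open Omega.
Hypothesis intN : leb.-integrable Omega (EFin \o N).
Hypothesis N0 : forall phi, test_function Omega phi ->
  \int[leb]_(x in Omega) (N x * phi x) = 0.

Let mOmega : measurable Omega := open_measurable_rV oOmega.

Let mN : measurable_fun Omega N.
Proof. by apply/measurable_EFinP; exact: (measurable_int _ intN). Qed.

(** Products of bumps converge to the indicator of the box, dominated by the absolute value of N.
    The closed box must lie in Omega for them to be test functions. *)
Lemma integral_open_box0 a b : closed_box a b `<=` Omega ->
  (\int[leb]_(x in open_box a b) (N x)%:E = 0)%E.
Proof.
move=> abO.
pose phi k := prodf (fun i => bump (a i) (b i) k.+1%:R^-1).
have k0 k : 0 < k.+1%:R^-1 :> R by rewrite invr_gt0 ltr0n.
have phi01 k x : 0 <= phi k x <= 1.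
  rewrite /phi /prodf; apply/andP; split.
    by apply: prodr_ge0 => i _; have /andP[] := bump_itv (a i) (b i) (x ord0 i) (k0 k).
  by apply: prodr_ile1 => i _; exact: bump_itv.
have boxO : open_box a b `<=` Omega.
  move=> x xab; apply: abO => i; have := xab i.
  by rewrite /= !in_itv/= => /andP[/ltW -> /ltW ->].
have mf k : measurable_fun Omega (fun x => (N x * phi k x)%:E).
  apply/measurable_EFinP; apply: measurable_funM => //.
  by apply: measurable_funTS; exact: measurable_prodf_bump.
have int0 k : (\int[leb]_(x in Omega) (N x * phi k x)%:E = 0)%E.
  have := N0 (test_function_bump (k0 k) abO).
  (* [Rintegral] is [fine] of an integral and is also 0 when that integral is infinite;
     integrability rules this case out. *)
  rewrite /Rintegral => /eqP; rewrite fine_eq0.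
    by move=> /eqP.
  apply: integrable_fin_num => //; apply: (le_integrable mOmega (mf k) _ intN) => x _.
  rewrite /= lee_fin normrM ler_piMr//.
  by have /andP[? ?] := phi01 k x; rewrite ger0_norm.
have := @dominated_cvg _ _ _ leb Omega mOmega (fun k x => (N x * phi k x)%:E)
  (fun x => (N x * \1_(open_box a b) x)%:E) (fun x => `|(N x)%:E|%E) mf.
have H1 x : Omega x -> (N x * phi k x)%:E @[k --> \oo] --> (N x * \1_(open_box a b) x)%:E.
  move=> _; apply: cvg_EFin; first exact: nearW.
  apply: cvgMl_tmp; rewrite indicE.
  rewrite (_ : _%:R = \prod_i (if a i < x ord0 i < b i then 1 else 0)); last first.
    have [xab|xab] := pselect (open_box a b x).
      rewrite mem_set//.
      by rewrite big1// => i _; have := xab i; rewrite /= in_itv/= => ->.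
    rewrite memNset//; move: xab => /existsNP[i /negP xi].
    by rewrite (bigD1 i)//=; move: xi; rewrite in_itv/= => /negbTE ->; rewrite mul0r.
  apply: cvg_bigprod => i; exact: bump_cvg.
have H2 x : Omega x -> `|(N x)%:E|%E \is a fin_num by [].
have H3 : leb.-integrable Omega (fun x => `|(N x)%:E|%E) by exact: integrable_abse.
have H4 k x : Omega x -> (`|(N x * phi k x)%:E| <= `|(N x)%:E|)%E.
  move=> _; rewrite /= lee_fin normrM ler_piMr//.
  by have /andP[? ?] := phi01 k x; rewrite ger0_norm.
move=> /(_ H1 H2 H3 H4); under eq_fun do rewrite int0.
move=> /cvg_lim; rewrite lim_cst// => /(_ (@ereal_hausdorff R)) ->.
rewrite -(setIidr boxO) integral_mkcondr; apply: eq_integral => x _.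
by rewrite (setIidr boxO) /patch indicE; case: ifPn => _; rewrite ?mulr1 ?mulr0.
Qed.

(** The sets E with this property form a Dynkin system containing the open boxes: the intersection
    of a box with the ball, itself a box, has its closure in Omega. *)
Lemma integral_inter_ball0 c r : 0 < r -> [set y | `|c - y| <= r] `<=` Omega ->
  forall E, measurable E -> (\int[leb]_(x in E `&` ball c r) (N x)%:E = 0)%E.
Proof.
move=> r0 cO E mE.
have bO : ball c r `<=` Omega.
  by move=> x; rewrite -ball_normE => /ltW; exact: cO.
have mB : measurable (ball c r) by apply: open_measurable_rV; exact: ball_open.
have intE F : measurable F -> leb.-integrable (F `&` ball c r) (EFin \o N).
  move=> mF; apply: integrableS intN => //; first exact: measurableI.
  by move=> x [_ /bO].
have box0 a b : (\int[leb]_(x in open_box a b `&` ball c r) (N x)%:E = 0)%E.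
  rewrite ball_open_box// open_boxI.
  apply: integral_open_box0 => x xab; apply: cO; apply: norm_coord_le; first exact: ltW.
  move=> i; have := xab i; rewrite /= in_itv/= ge_max le_min => /andP[/andP[_ ?] /andP[_ ?]].
  by rewrite !mxE ler_norml; apply/andP; split; lra.
have ballT : (\int[leb]_(x in ball c r) (N x)%:E = 0)%E.
  have := box0 (fun i => c ord0 i - r) (fun i => c ord0 i + r).
  by rewrite -ball_open_box// setIid.
apply: (@dynkin_induction _ 'rV[R]_n [set B | exists a b, B = open_box a b]
  (fun E => \int[leb]_(x in E `&` ball c r) (N x)%:E = 0)%E); rewrite ?setTI//.
- exact: measurable_rVE.
- exact: open_box_setI_closed.
- by move=> _ [a [b ->]].
- move=> S mS S0; have := ballT.
  have mfS : measurable_fun (S `&` ball c r `|` ~` S `&` ball c r) (EFin \o N).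
    rewrite -setIUl setUCr; exact: measurable_int (intE _ measurableT).
  rewrite -{1}[ball c r]setTI -(setUCr S) setIUl integral_setU//.
  - by rewrite S0 add0e.
  - exact: measurableI.
  - by apply: measurableI => //; exact: measurableC.
  - by apply/disj_setPS => x [[Sx _] [nSx _]].
- move=> F mF tF F0; rewrite setI_bigcupl integral_bigcup//.
  + by apply: eseries0 => k _ _; exact: F0.
  + by apply/trivIset_setIr.
  + by move=> k; exact: measurableI.
  + by rewrite -setI_bigcupl; apply: intE; exact: bigcupT_measurable.
- by rewrite -measurable_rVE.
Qed.

(** On each of the countably many rational balls filling Omega, the integral of N over every
    measurable subset vanishes, which forces N to vanish there almost everywhere. *)
Lemma du_bois_reymond : leb.-negligible (Omega `&` [set x | N x != 0]).
Proof.
pose good (p : 'rV[rat]_n * nat) :=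
  [set y : 'rV[R]_n | `|map_mx ratr p.1 - y| <= p.2.+1%:R^-1] `<=` Omega.
pose B (p : 'rV[rat]_n * nat) := ball (map_mx ratr p.1 : 'rV[R]_n) p.2.+1%:R^-1.
pose F k := if unpickle k is Some p then
  (if `[< good p >] then B p `&` [set x | N x != 0] else set0) else set0.
apply: (@negligibleS _ _ _ _ (\bigcup_k F k)).
  move=> x [+ Nx]; rewrite (open_rat_balls oOmega) => -[p /= gp xp].
  by exists (pickle p) => //; rewrite /F pickleK asboolT.
apply: negligible_bigcup => k; rewrite /F.
case: unpickle => [p|]; last exact: negligible_set0.
case: asboolP => [gp|_]; last exact: negligible_set0.
have p0 : 0 < p.2.+1%:R^-1 :> R by rewrite invr_gt0 ltr0n.
have BO : B p `<=` Omega.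
  by move=> x; rewrite /B -ball_normE => /ltW; exact: gp.
have mB : measurable (B p) by apply: open_measurable_rV; exact: ball_open.
have intB : leb.-integrable (B p) (EFin \o N) by exact: integrableS intN.
have [] := @integral_ae_eq _ _ _ leb (B p) mB (cst 0%E) (EFin \o N) intB.
- exact: measurable_cst.
- move=> E EB mE; rewrite integral0 -(setIidl EB).
  exact: (integral_inter_ball0 p0 gp mE).
move=> A [mA A0 BA]; exists A; split => // x [Bx /eqP Nx].
by apply: BA => /= /(_ Bx) [].
Qed.

End du_bois_reymond.
End test_functions.

(** * Hausdorff measure *)

Section hausdorff_properties.
Context {R : realType} {n s : nat}.
Implicit Types X Y : set 'rV[R]_n.
Local Notation H := (@hausdorff R n s).
Local Notation gauge := (@hausdorff_gauge R n s).
Local Open Scope ereal_scope.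

Lemma hausdorff_gauge_anti (d1 d2 : R) X : (d1 <= d2)%R -> gauge d2 X <= gauge d1 X.
Proof.
move=> d12; rewrite /hausdorff_gauge; case: ifPn => h2; case: ifPn => h1.
- by [].
- exact: leey.
- exfalso; move/asboolPn : h2; apply => x y Xx Xy.
  by move/asboolP : h1 => /(_ x y Xx Xy)/le_trans; apply.
- by [].
Qed.

Lemma mu_ext_hausdorff_anti (d1 d2 : R) X : (d1 <= d2)%R ->
  mu_ext (gauge d2) X <= mu_ext (gauge d1) X.
Proof.
move=> d12; apply: le_ereal_inf_tmp => _ [F FX <-].
apply: ereal_inf_le; eexists; first by exists F => //; reflexivity.
apply: lee_nneseries => k *; first exact: hausdorff_gauge_ge0.
exact: hausdorff_gauge_anti.
Qed.

(** A set of diameter at most d cannot meet both X and Y, so a cover of the union splits into a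
    cover of each. A member meeting both has gauge [+oo], which makes the bound trivial at that
    index. *)
Lemma mu_ext_hausdorff_separated (d : R) X Y :
  (forall x y, X x -> Y y -> d < enorm (x - y))%R ->
  mu_ext (gauge d) X + mu_ext (gauge d) Y <= mu_ext (gauge d) (X `|` Y).
Proof.
move=> XY; apply: le_ereal_inf_tmp => _ [F [mF XYF] <-].
pose G Z k := if `[< F k `&` Z !=set0 >] then F k else set0.
have coverG Z : Z `<=` X `|` Y -> measurable_cover Z (G Z).
  move=> ZXY; split => [k|z Zz]; first by rewrite /G; case: ifP.
  have [k _ Fkz] := XYF z (ZXY z Zz); exists k => //.
  by rewrite /G asboolT//; exists z.
have muG Z : Z `<=` X `|` Y -> mu_ext (gauge d) Z <= \sum_(k <oo) gauge d (G Z k).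
  by move=> /coverG GZ; apply: ereal_inf_lbound; exists (G Z).
apply: le_trans (leeD (muG X _) (muG Y _)) _; [by left|by right|].
rewrite -nneseriesD; [|by move=> *; exact: hausdorff_gauge_ge0..].
apply: lee_nneseries => k *; first by rewrite adde_ge0// hausdorff_gauge_ge0.
rewrite /G; case: asboolP => [[x [Fx Xx]]|_]; case: asboolP => [[y [Fy Yy]]|_].
- suff -> : gauge d (F k) = +oo by exact: leey.
  rewrite /hausdorff_gauge asboolF// => /(_ x y Fx Fy).
  by rewrite leNgt XY.
- by rewrite hausdorff_gauge0 adde0.
- by rewrite hausdorff_gauge0 add0e.
- by rewrite hausdorff_gauge0 add0e hausdorff_gauge_ge0.
Qed.

Lemma mu_ext_le_hausdorff (d : R) X : (0 < d)%R -> mu_ext (gauge d) X <= H X.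
Proof. by move=> d0; apply: ereal_sup_ubound; exists d. Qed.

Lemma hausdorff_separated (e : R) X Y : (0 < e)%R ->
  (forall x y, X x -> Y y -> e <= enorm (x - y))%R ->
  H X + H Y <= H (X `|` Y).
Proof.
move=> e0 XY; have [->|Hoo] := eqVneq (H (X `|` Y)) +oo; first exact: leey.
have Hfin : H (X `|` Y) \is a fin_num.
  by rewrite ge0_fin_numE ?outer_measure_ge0// ltey.
have XYd d1 d2 : (0 < d1)%R -> (0 < d2)%R ->
    mu_ext (gauge d1) X + mu_ext (gauge d2) Y <= H (X `|` Y).
  (* Half of e gives the strict separation that splitting a cover requires; taking d below both [d1]
     and [d2] lets the two suprema be handled independently. *)
  move=> d10 d20; pose d := Num.min (e / 2)%R (Num.min d1 d2).
  have d0 : (0 < d)%R by rewrite !lt_min d10 d20 divr_gt0.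
  apply: le_trans (mu_ext_le_hausdorff _ d0).
  apply: le_trans (mu_ext_hausdorff_separated _); last first.
    move=> x y Xx Yy; apply: lt_le_trans (XY x y Xx Yy).
    by rewrite /d gt_min ltr_pdivrMr// ltr_pMr// ltr1n.
  by apply: leeD; apply: mu_ext_hausdorff_anti; rewrite !ge_min lexx ?orbT.
have fin_muY d : (0 < d)%R -> mu_ext (gauge d) Y \is a fin_num.
  move=> d0; rewrite ge0_fin_numE; last first.
    by apply: mu_ext_ge0 => ?; exact: hausdorff_gauge_ge0.
  apply: (@le_lt_trans _ _ (H (X `|` Y))); last by rewrite ltey.
  apply: le_trans (mu_ext_le_hausdorff _ d0) _.
  by apply: le_outer_measure; right.
have finX : H X \is a fin_num.
  rewrite ge0_fin_numE ?outer_measure_ge0//.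
  apply: (@le_lt_trans _ _ (H (X `|` Y))); last by rewrite ltey.
  by apply: le_outer_measure; left.
rewrite -leeBrDl//; apply: ge_ereal_sup => _ [d2 d20 <-].
rewrite leeBrDl// -leeBrDr ?fin_muY//; apply: ge_ereal_sup => _ [d1 d10 <-].
by rewrite leeBrDr ?fin_muY// XYd.
Qed.

Lemma coord_le_enorm (x : 'rV[R]_n) i : (`|x ord0 i| <= enorm x)%R.
Proof.
rewrite -sqrtr_sqr /enorm; apply: ler_wsqrtr.
by rewrite (bigD1 i)//= lerDl; apply: sumr_ge0 => j _; exact: sqr_ge0.
Qed.

Lemma hausdorff_separated_coord (i : 'I_n) (a b : R) X Y : (a < b)%R ->
  (forall x, X x -> x ord0 i <= a)%R -> (forall y, Y y -> b <= y ord0 i)%R ->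
  H X + H Y <= H (X `|` Y).
Proof.
move=> ab Xa Yb; apply: (@hausdorff_separated (b - a)); first by rewrite subr_gt0.
move=> x y /Xa xa /Yb yb; apply: le_trans (coord_le_enorm _ i).
by rewrite !mxE distrC; apply: le_trans (ler_norm _); lra.
Qed.

(* Caratheodory's criterion for the metric outer measure H: the slabs
   s_k < x_i <= s_(k+1) with k of fixed parity are at positive mutual distance,
   so their measures are summable. *)
Lemma hausdorff_halfspace_split (i : 'I_n) (c : R) X :
  H (X `&` [set x | (x ord0 i < c)%R]) + H (X `&` ~` [set x | (x ord0 i < c)%R])
    <= H X.
Proof.
have [->|Hoo] := eqVneq (H X) +oo; first exact: leey.
have HXoo : H X < +oo by rewrite ltey.
pose t k : R := (c - k.+1%:R^-1)%R.
have t_incr k l : (k < l)%N -> (t k < t l)%R.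
  by move=> kl; rewrite /t ltrD2l ltrN2 ltf_pV2 ?posrE ?ltr0n// ltr_nat.
have tc k : (t k < c)%R by rewrite /t ltrBlDr ltrDl invr_gt0 ltr0n.
pose B k := X `&` [set x | (x ord0 i <= t k)%R].
pose S k := X `&` [set x | (t k < x ord0 i <= t k.+1)%R].
have BX k : H (B k) <= H X by apply: le_outer_measure; exact: subIsetl.
(* [B k] and [S k.+1] are kept apart by the slab [S k], of width [t k.+1 - t k]. *)
have step k : H (B k) + H (S k.+1) <= H (B k.+2).
  apply: le_trans (@hausdorff_separated_coord i (t k) (t k.+1) _ _ _ _ _) _.
  - exact: t_incr.
  - by move=> x [_].
  - by move=> x [_ /= /andP[/ltW]].
  - apply: le_outer_measure => x [[Xx /= xk]|[Xx /= /andP[_ xk]]]; split => //=.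
    by apply: le_trans xk _; exact/ltW/t_incr.
(* Even and odd slabs are accumulated at the same time, each chain through [step]; hence the two
   terms on the right. *)
have sumS N : \sum_(0 <= k < N.*2) H (S k.+1) <= H (B N.*2) + H (B N.*2.+1).
  elim: N => [|N IH].
    by rewrite big_geq// adde_ge0// outer_measure_ge0.
  rewrite doubleS !big_nat_recr//= -addeA.
  apply: le_trans (leeD IH (lexx _)) _.
  by rewrite addeACA; apply: leeD; exact: step.
have sumSoo : \sum_(k <oo) H (S k.+1) < +oo.
  apply: (@le_lt_trans _ _ (H X + H X)); last by rewrite lte_add_pinfty.
  apply: lime_le; first by apply: is_cvg_nneseries => *; exact: outer_measure_ge0.
  near=> N; apply: (@le_trans _ _ (\sum_(0 <= k < N.*2) H (S k.+1))).
    rewrite [leRHS](@big_cat_nat _ _ _ N)//=; last by rewrite -addnn leq_addr.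
    by rewrite leeDl// sume_ge0// => *; exact: outer_measure_ge0.
  by apply: le_trans (sumS N) _; apply: leeD.
(* The levels [t k] tend to c, so a point below c that [B k.+1] misses lies in some slab [S j.+1]
   with [k <= j]. *)
have tail k : H (X `&` [set x | (x ord0 i < c)%R]) <=
    H (B k.+1) + \sum_(k <= j <oo) H (S j.+1).
  apply: le_trans (le_trans (outer_measureU2 H (B k.+1) (\bigcup_(j in ~` `I_k) S j.+1)) _).
    apply: le_outer_measure => x [Xx /= xc].
    have [xk|xk] := leP (x ord0 i) (t k.+1); [by left|right].
    have : exists l, (x ord0 i <= t l)%R.
      exists (Num.truncn (c - x ord0 i)^-1); rewrite /t lerBrDl -lerBrDr.
      rewrite -[leRHS]invrK lef_pV2 ?posrE ?invr_gt0 ?subr_gt0 ?ltr0n//.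
      exact/ltW/truncnS_gt.
    case/ex_minnP => -[|l] xl lmin.
      exfalso; move: xk; rewrite ltNge => /negP; apply; apply: (le_trans xl).
      exact/ltW/t_incr.
    have lx : (t l < x ord0 i)%R.
      by rewrite ltNge; apply/negP => /lmin; rewrite ltnn.
    have kl : (k.+1 < l.+1)%N.
      rewrite ltnNge; apply/negP => lk; move: xk; rewrite ltNge => /negP; apply.
      apply: (le_trans xl); move: lk; rewrite leq_eqVlt => /predU1P[->//|].
      by move/t_incr/ltW.
    case: l => // l in xl lmin lx kl *.
    exists l; first by rewrite /= /setC /=; apply/negP; rewrite -leqNgt.
    by split => //=; rewrite lx xl.
  by apply: leeD => //; exact: outer_measure_sigma_subadditive_tail.
apply/lee_addgt0Pr => e e0.
have : (\sum_(k <= j <oo) H (S j.+1)) @[k --> \oo] --> 0.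
  by apply: nneseries_tail_cvg => // *; exact: outer_measure_ge0.
move=> /fine_cvgP[fint /cvgrPdist_lt/(_ e e0)] [K _ Ke].
have [K' _ fin'] := fint.
pose k := maxn K K'.
have tke : \sum_(k <= j <oo) H (S j.+1) <= e%:E.
  have := Ke k (leq_maxl _ _); have := fin' k (leq_maxr _ _).
  rewrite /= sub0r normrN => /fineK <- /(le_lt_trans (ler_norm _)).
  by rewrite lee_fin => /ltW.
apply: le_trans (leeD (tail k) (lexx _)) _.
rewrite addeAC; apply: leeD => //.
apply: le_trans (@hausdorff_separated_coord i (t k.+1) c _ _ _ _ _) _ => //.
- by move=> x [_].
- by move=> x [_ /=] /negP; rewrite -leNgt.
- by apply: le_outer_measure => x [[]|[]].
Unshelve. all: by end_near. Qed.

Lemma hausdorff_halfspace_caratheodory (i : 'I_n) (c : R) :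
  H.-caratheodory [set x : 'rV[R]_n | (x ord0 i < c)%R].
Proof. by apply: le_caratheodory_measurable => X; exact: hausdorff_halfspace_split. Qed.

(** Half-spaces generate the Borel sets, so Borel functions are measurable on the Caratheodory
    sigma-algebra. This makes piecewise affine functions integrable against the surface measure. *)
Lemma measurable_hausdorff_id :
  measurable_fun [set: caratheodory_type H] (fun x => x : 'rV[R]_n).
Proof.
apply: measurable_fun_rV => i.
apply: (@measurability _ _ _ _ _ _ (@RGenInftyO.G R)).
  exact: RGenInftyO.measurableE.
move=> _ [_ [x ->] <-]; rewrite setTI.
rewrite (_ : _ @^-1` _ = [set y : 'rV[R]_n | (y ord0 i < x)%R]).
  exact: hausdorff_halfspace_caratheodory.
by apply/seteqP; split => y; rewrite /= in_itv.
Qed.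

End hausdorff_properties.

(** * Finiteness of the Hausdorff measure of parallelepipeds *)

Section parallelepiped.
Context {R : realType}.

(** Every Hausdorff gauge carries this normalising factor, which must be finite for the covering
    estimates to be of use; the Euclidean ball sits in a cube. *)
Lemma ball_volume_lty s : (ball_volume R s < +oo)%E.
Proof.
have E : [set x : 'rV[R]_s | enorm x <= 1] = [set x | \sum_i x ord0 i ^+ 2 <= 1].
  apply/seteqP; split => x /=; rewrite /enorm => x1.
    rewrite -[leLHS]sqr_sqrtr ?exprn_ile1 ?sqrtr_ge0//.
    by apply: sumr_ge0 => *; exact: sqr_ge0.
  by rewrite -[leRHS]sqrtr1; exact: ler_wsqrtr.
apply: (@le_lt_trans _ _ (lebesgue_rV R s [set x | \sum_i x ord0 i ^+ 2 <= 1])).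
  by rewrite /ball_volume -E.
apply: lebesgue_rV_bounded.
  apply: closed_measurable_rV.
  suff : closed ((fun x : 'rV[R]_s => \sum_i x ord0 i ^+ 2) @^-1` [set t | t <= 1]).
    by [].
  apply: closed_comp => [x _|]; last exact: closed_le.
  move: x; apply: continuous_bigsum => i.
  by under eq_fun do rewrite expr2; apply: continuous_mulfun; exact: coord_continuous.
apply: (@bounded_by _ _ _ 1) => x /= x1; apply: norm_coord_le => // i.
rewrite -(@ler_pXn2r _ 2) ?nnegrE// expr1n -normrX ger0_norm ?sqr_ge0//.
apply: le_trans x1; rewrite (bigD1 i)//= lerDl.
by apply: sumr_ge0 => j _; exact: sqr_ge0.
Qed.

Lemma enorm_le n (x : 'rV[R]_n) r : 0 <= r -> (forall i, `|x ord0 i| <= r) ->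
  enorm x <= n%:R * r.
Proof.
move=> r0 xr; rewrite -[leRHS]ger0_norm ?mulr_ge0// -sqrtr_sqr.
apply: ler_wsqrtr; apply: (@le_trans _ _ (\sum_(i < n) r ^+ 2)).
  apply: ler_sum => i _; rewrite -real_normK ?num_real// ler_pXn2r// nnegrE.
rewrite sumr_const card_ord exprMn -[leLHS]mulr_natl ler_wpM2r ?sqr_ge0//.
by rewrite -natrX ler_nat; case: (n) => // k; rewrite expnS expn1 leq_pmulr.
Qed.

Lemma unit_interval_grid (m : nat) (t : R) : 0 <= t <= 1 ->
  exists k : 'I_m.+1, `|t - k%:R / m.+1%:R| <= m.+1%:R^-1.
Proof.
move=> /andP[t0 t1]; have m0 : 0 < m.+1%:R :> R by rewrite ltr0n.
pose k := Num.truncn (t * m.+1%:R).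
have kle : k%:R <= t * m.+1%:R by rewrite truncn_le// mulr_ge0// ltW.
have klt : t * m.+1%:R < k.+1%:R := truncnS_gt _.
have dist j : j%:R <= t * m.+1%:R -> t * m.+1%:R <= j.+1%:R ->
    `|t - j%:R / m.+1%:R| <= m.+1%:R^-1.
  move=> jle ltj; rewrite ger0_norm; last by rewrite subr_ge0 ler_pdivrMr.
  by rewrite lerBlDr -[X in X + _]mul1r -mulrDl ler_pdivlMr// nat1r.
(* Only t = 1 is rounded past the last node m / (m + 1); it is attached to that node, at distance 1
   / (m + 1). *)
have [km|km] := ltnP k m.+1; first by exists (Ordinal km); apply: dist => //; exact: ltW.
exists ord_max => /=; apply: dist; last by rewrite -[leRHS]mul1r ler_wpM2r// ltW.
by apply: le_trans kle; rewrite ler_nat ltnW.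
Qed.

Definition parallelepiped n s (p : 'rV[R]_n) (w : 'I_s -> 'rV[R]_n) :=
  [set x | exists2 l : 'I_s -> R,
     (forall k, 0 <= l k <= 1) & x = p + \sum_k l k *: w k].

(* A grid of step 1/m in the s parameters gives m^s cells of diameter O(1/m),
   hence a total gauge that is bounded in m. *)
Lemma hausdorff_parallelepiped n s (p : 'rV[R]_n) (w : 'I_s -> 'rV[R]_n) :
  (hausdorff s (parallelepiped p w) < +oo)%E.
Proof.
set P := parallelepiped p w.
pose c : R := \sum_k `|w k|.
have c0 : 0 <= c by exact: sumr_ge0.
(* There will be [(m + 1) ^ s] cells, each of gauge at most [ball_volume R s] times
   [(n * c / (m + 1)) ^ s]; the powers of m + 1 cancel. *)
pose C : \bar R := (ball_volume R s * ((n%:R * c) ^+ s)%:E)%E.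
have bv0 : (0 <= ball_volume R s)%E by exact: measure_ge0.
have C0 : (0 <= C)%E by rewrite mule_ge0// lee_fin exprn_ge0// mulr_ge0.
suff PC : (hausdorff s P <= C)%E.
  apply: (le_lt_trans PC); rewrite /C.
  by rewrite lte_mul_pinfty ?ltry// ge0_fin_numE// ball_volume_lty.
apply: ge_ereal_sup => _ [d /= d0 <-].
(* Cells will be cubes of half-side [r = c / (m + 1)] around the grid points, of Euclidean diameter
   at most [2 * n * r]; this m brings that below d. *)
pose m := Num.truncn (2 * n%:R * c / d).
have m0 : 0 < m.+1%:R :> R by rewrite ltr0n.
have md : 2 * n%:R * c / m.+1%:R <= d.
  by rewrite ler_pdivrMr// [leRHS]mulrC -ler_pdivrMr//; exact/ltW/truncnS_gt.
pose r := c / m.+1%:R.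
have r0 : 0 <= r by rewrite divr_ge0// ltW.
pose Q (k : {ffun 'I_s -> 'I_m.+1}) : set 'rV[R]_n :=
  box (fun i => `[(p + \sum_j ((k j)%:R / m.+1%:R) *: w j) ord0 i - r,
                  (p + \sum_j ((k j)%:R / m.+1%:R) *: w j) ord0 i + r]%classic).
pose N := #|{ffun 'I_s -> 'I_m.+1}|.
pose F (i : nat) := if insub i is Some j then Q (enum_val (j : 'I_N)) else set0.
have Qd k x y : Q k x -> Q k y -> enorm (x - y) <= n%:R * (2 * r).
  move=> Qx Qy; apply: enorm_le => [|i]; first by rewrite mulr_ge0.
  have := Qx i; have := Qy i; rewrite /= !in_itv/= => /andP[? ?] /andP[? ?].
  by rewrite !mxE ler_norml; apply/andP; split; lra.
have gQ k : (hausdorff_gauge s d (Q k) <= ball_volume R s * ((n%:R * r) ^+ s)%:E)%E.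
  rewrite /hausdorff_gauge asboolT; last first.
    move=> x y /Qd/[apply]/le_trans; apply; apply: le_trans md.
    by rewrite /r mulrCA !mulrA.
  apply: lee_wpmul2l => //; apply: ge_ereal_sup => _ [->|[x [y [Qx Qy ->]]]].
    by rewrite lee_fin exprn_ge0// mulr_ge0.
  rewrite lee_fin lerXn2r ?nnegrE ?mulr_ge0// ?divr_ge0 ?sqrtr_ge0//.
  by rewrite ler_pdivrMr// (le_trans (Qd _ _ _ Qx Qy))// mulrA -mulrA [2 * _]mulrC mulrA.
apply: (@le_trans _ _ (\sum_(k <oo) hausdorff_gauge s d (F k))%E).
  apply: ereal_inf_lbound; exists F => //; split => [i|x [l l01 ->]].
    by rewrite /F; case: insubP => // *; exact: measurable_box.
  have /choice[k kl] := fun j => unit_interval_grid m (l01 j).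
  exists (enum_rank [ffun j => k j]) => //=; rewrite /F valK enum_rankK => i.
  rewrite /= in_itv/= -ler_distlC distrC.
  rewrite [X in `|X|](_ : _ =
     (\sum_j (l j - (k j)%:R / m.+1%:R) *: w j) ord0 i); last first.
    rewrite !mxE opprD addrACA subrr add0r !summxE -sumrN -big_split/=.
    by apply: eq_bigr => j _; rewrite !ffunE !mxE mulrBl.
  apply: le_trans (coord_le_norm _ _) _; apply: le_trans (ler_norm_sum _ _ _) _.
  rewrite /r /c mulr_suml; apply: ler_sum => j _.
  by rewrite normrZ mulrC ler_wpM2l.
apply: lime_le; first by apply: is_cvg_nneseries => *; exact: hausdorff_gauge_ge0.
near=> M.
apply: (@le_trans _ _ (\sum_(0 <= i < N) hausdorff_gauge s d (F i))%E).
  rewrite (@big_cat_nat _ _ _ N)//=; last by near: M; exact: nbhs_infty_ge.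
  rewrite [X in (_ + X)%E]big_nat_cond [X in (_ + X)%E]big1 ?adde0// => i /andP[/andP[Ni _] _].
  by rewrite /F insubN ?hausdorff_gauge0// -leqNgt.
rewrite big_mkord.
apply: (@le_trans _ _ (\sum_(i < N) (ball_volume R s * ((n%:R * r) ^+ s)%:E))%E).
  by apply: lee_sum => i _; rewrite /F valK.
have bvfin : ball_volume R s \is a fin_num by rewrite ge0_fin_numE ?ball_volume_lty.
rewrite /C -(fineK bvfin) -EFinM sumEFin lee_fin sumr_const card_ord -[leLHS]mulr_natr -mulrA.
rewrite ler_wpM2l ?fine_ge0// /N card_ffun !card_ord natrX -exprMn.
by rewrite /r -mulrA divfK ?gt_eqF.
Unshelve. all: by end_near. Qed.

End parallelepiped.

(** * Weak derivatives of locally Lipschitz functions *)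

Section bounded_functions_on_finite_measure.
Context d {T : measurableType d} {R : realType}.
Variables (mu : {measure set T -> \bar R}) (D : set T).
Hypotheses (mD : measurable D) (muD : (mu D < +oo)%E).

Lemma integrable_bounded (f : T -> R) M : measurable_fun D f ->
  (forall x, D x -> `|f x| <= M) -> mu.-integrable D (EFin \o f).
Proof.
move=> mf fM; apply: measurable_bounded_integrable => //.
exists M; split; first exact: num_real.
by move=> N /ltW MN x Dx; exact: le_trans (fM x Dx) MN.
Qed.

Lemma Rintegral_bounded_cvg (f_ : nat -> T -> R) (f : T -> R) M :
  (forall k, measurable_fun D (f_ k)) -> measurable_fun D f ->
  {ae mu, forall x, D x -> f_ k x @[k --> \oo] --> f x} ->
  (forall k x, D x -> `|f_ k x| <= M) ->
  \int[mu]_(x in D) f_ k x @[k --> \oo] --> \int[mu]_(x in D) f x.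
Proof.
move=> mf_ mf ff fM.
have [||||| intf _ cvgf] := @dominated_convergence _ _ _ mu D mD
  (fun k x => (f_ k x)%:E) (fun x => (f x)%:E) (cst M%:E).
- by move=> k; exact/measurable_EFinP.
- exact/measurable_EFinP.
- move: ff => [A [mA A0 ffA]]; exists A; split => // x nx; apply: ffA => /= h; apply: nx.
  by move=> Dx; apply: cvg_EFin; [exact: nearW|exact: h].
- exact: (integrable_bounded (f := cst M) (M := `|M|)).
- by apply: aeW => x k Dx; rewrite /= lee_fin fM.
apply: fine_cvg; rewrite fineK//; exact: integrable_fin_num.
Qed.

End bounded_functions_on_finite_measure.

Lemma Rintegral_translation {R : realType} {n : nat} (v : 'rV[R]_n) (f : 'rV[R]_n -> R) :
  measurable_fun setT f -> (lebesgue_rV R n).-integrable setT (EFin \o (fun x => f (x + v))) ->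
  \int[lebesgue_rV R n]_x f (x + v) = \int[lebesgue_rV R n]_x f x.
Proof.
move=> mf intf; rewrite /Rintegral; congr fine.
have mv : measurable_fun [set: 'rV[R]_n] (+%R^~ v).
  apply: measurable_fun_rV => i; under eq_fun do rewrite mxE.
  by apply: measurable_funD => //; exact: measurable_coord.
have := @integral_pushforward _ _ _ _ _ _ mv (lebesgue_rV R n) setT (EFin \o f).
rewrite preimage_setT => <-//; last exact/measurable_EFinP.
by apply: eq_measure_integral => A mA _; exact: lebesgue_rV_translation.
Qed.

(** Let s be the supremum of the points up to which the bound from 0 holds. The local bound at s
    shows that s is such a point, and would carry the bound beyond s if s < b. Nearby points are
    only ever compared with s, so a pointwise hypothesis is enough and L is not degraded. *)
Lemma lipschitz_of_local {R : realType} (f : R -> R) (L b : R) : 0 <= b ->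
  (forall s, 0 <= s <= b -> \forall t \near s, `|f t - f s| <= L * `|t - s|) ->
  `|f b - f 0| <= L * b.
Proof.
move=> b0 loc.
pose A := [set t | 0 <= t <= b /\ `|f t - f 0| <= L * t].
have A0 : A 0 by split; rewrite ?lexx ?b0// subrr normr0 mulr0.
have ubA : ubound A b by move=> t [/andP[]].
have supA : has_sup A by split; [exists 0|exists b].
pose s := sup A.
have s0 : 0 <= s by apply: sup_upper_bound.
have sb : s <= b by apply: ge_sup => //; exists 0.
have /nbhs_ballP[e /= e0 es] := loc s (introT andP (conj s0 sb)).
have As : A s.
  split; first by rewrite s0.
  have [t At st] := sup_adherent e0 supA.
  have ts : t <= s by apply: sup_upper_bound.
  have [_ ft] := At.
  have : `|f t - f s| <= L * `|t - s|.
    by apply: es; rewrite /ball/= ger0_norm ?subr_ge0//; rewrite -/s in st; lra.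
  rewrite (ler0_norm (_ : t - s <= 0)) ?subr_le0// => fts.
  have := ler_distD (f t) (f s) (f 0); rewrite (distrC (f s) (f t)); lra.
have [sE|sb'] := eqVneq s b; first by case: As => _; rewrite sE.
have {}sb' : s < b by rewrite lt_neqAle sb'.
pose t := Num.min (s + e / 2) b.
have st : s < t by rewrite lt_min sb' ltrDl divr_gt0.
have tb : t <= b by rewrite ge_min lexx orbT.
have te : t <= s + e / 2 by rewrite ge_min lexx.
suff At : A t by have := sup_upper_bound supA At; rewrite leNgt st.
split; first by rewrite tb (le_trans s0 (ltW st)).
have : `|f t - f s| <= L * `|t - s|.
  by apply: es; rewrite /ball/= distrC gtr0_norm ?subr_gt0//; lra.
rewrite (gtr0_norm (_ : 0 < t - s)) ?subr_gt0// => fts.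
by case: As => _ fs; have := ler_distD (f s) (f t) (f 0); lra.
Qed.

Lemma is_derive_line {R : realType} {n : nat} (phi : 'rV[R]_n -> R) (x e : 'rV[R]_n) (s : R) :
  derivable phi (x + s *: e) e ->
  is_derive s (1 : R) (fun s => phi (x + s *: e)) ('D_e phi (x + s *: e)).
Proof.
move=> dphi.
have E : (fun h : R => h^-1 *: (((fun s => phi (x + s *: e)) \o shift s) (h *: (1 : R)) -
    phi (x + s *: e))) = (fun h => h^-1 *: ((phi \o shift (x + s *: e)) (h *: e) -
    phi (x + s *: e))).
  apply/funext => h /=; congr (_ *: (phi _ - _)).
  by rewrite [_%:A]mulr1 scalerDl addrCA.
by apply: DeriveDef; rewrite /derivable /derive /= E.
Qed.

Section weak_partial_derivative.
Context {R : realType} {n : nat}.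
Local Notation leb := (lebesgue_rV R n).
Local Notation E := 'rV[R]_n.

Lemma bounded_compact_support (phi : E -> R) (K : set E) : continuous phi ->
  compact K -> (forall x, ~ K x -> phi x = 0) ->
  exists2 M, 0 <= M & forall x, `|phi x| <= M.
Proof.
move=> cphi cK phi0.
have : compact (phi @` K).
  by apply: continuous_compact => //; exact: continuous_subspaceT.
move=> /compact_bounded[M [_ /(_ (`|M| + 1))]].
rewrite ltr_pwDr ?ler_norm// => /(_ isT) phiM.
exists (`|M| + 1) => [|x]; first by rewrite addr_ge0.
have [Kx|/phi0 ->] := pselect (K x); last by rewrite normr0 addr_ge0.
by apply: phiM; exists x.
Qed.

(** Provides one step size below which all shifts of the support of a test function stay in
    Omega. *)
Lemma compact_thickening (Omega K : set E) : open Omega -> compact K -> K `<=` Omega ->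
  exists2 d, 0 < d & forall x y, K x -> `|x - y| <= d -> Omega y.
Proof.
move=> oO /compact_near_coveringP cK KO.
pose P (d : R) (x : E) := forall y, `|x - y| <= d -> Omega y.
have : \forall d \near (0 : R)^'+, K `<=` P d.
  apply: (cK _ _ P) => x Kx.
  have /nbhs_ballP[r /= r0 xrO] : nbhs x Omega.
    by apply: open_nbhs_nbhs; split => //; exact: KO.
  exists (ball x (r / 2), [set d | d < r / 2]) => /=.
    split; first by apply/nbhs_ballP; exists (r / 2) => //=; exact: divr_gt0.
    by apply: nbhs_right_lt; exact: divr_gt0.
  move=> [y d] [/= xy dr] z yz; apply: xrO; rewrite -ball_normE/=.
  apply: le_lt_trans (ler_distD y x z) _; rewrite (splitr r) ltrD//.
    by move: xy; rewrite -ball_normE.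
  exact: le_lt_trans yz dr.
move=> KP; have : \forall d \near (0 : R)^'+, 0 < d /\ K `<=` P d.
  by near=> d; split; [near: d; exact: nbhs_right_gt|near: d].
by move=> /filter_ex[d [d0 Kd]]; exists d => // x y /Kd; exact.
Unshelve. all: by end_near. Qed.

Lemma norm_delta_mx_le (i : 'I_n) : `|delta_mx ord0 i : E| <= 1.
Proof. by apply: norm_coord_le => // j; rewrite mxE eqxx; case: eqP; rewrite ?normr1 ?normr0. Qed.

Variables (Omega : set E) (v G : E -> R) (i : 'I_n) (M L : R).
Hypotheses (oO : open Omega) (bO : bounded_set Omega).
Hypotheses (mv : measurable_fun Omega v) (mG : measurable_fun Omega G).
Hypothesis (L0 : 0 <= L).
Hypotheses (vM : forall x, Omega x -> `|v x| <= M) (GL : forall x, Omega x -> `|G x| <= L).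
Hypothesis v_lip : forall x, Omega x ->
  \forall y \near x, `|v y - v x| <= L * `|y - x|.
Let e : E := delta_mx ord0 i.
Hypothesis v_diff : {ae leb, forall x, Omega x ->
  \forall t \near (0 : R), v (x + t *: e) - v x = t * G x}.

Let mO : measurable Omega := open_measurable_rV oO.
Let leb_O : (leb Omega < +oo)%E := lebesgue_rV_bounded mO bO.

(** Omega need not be convex, so the local bound is integrated only along segments known to lie in
    Omega. This dominates the difference quotients of v. *)
Lemma lipschitz_on_segment x b : 0 <= b ->
  (forall s, 0 <= s <= b -> Omega (x - s *: e)) ->
  `|v (x - b *: e) - v x| <= L * b.
Proof.
move=> b0 seg.
have := @lipschitz_of_local R (fun s => v (x - s *: e)) L b b0.
rewrite scale0r subr0; apply => s sb.
have cs : continuous (fun t : R => x - t *: e).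
  by move=> t; apply: cvgB; [exact: cvg_cst|apply: cvgZr_tmp; exact: cvg_id].
have near_s : \forall t \near s, `|v (x - t *: e) - v (x - s *: e)| <=
  L * `|x - t *: e - (x - s *: e)| := cs s _ (v_lip (seg s sb)).
apply: filterS near_s => t /le_trans; apply; rewrite ler_wpM2l//.
have -> : x - t *: e - (x - s *: e) = (s - t) *: e.
  by rewrite opprB addrC addrA subrK scalerBl.
by rewrite normrZ distrC ler_piMr// norm_delta_mx_le.
Qed.

Variable phi : E -> R.
Hypothesis tphi : test_function Omega phi.

(* Translation invariance of the Lebesgue measure moves the shift of the
   difference quotient from phi to v; dominated convergence does the rest. *)
Lemma weak_partial :
  \int[leb]_(x in Omega) (v x * partial i phi x) =
  - \int[leb]_(x in Omega) (G x * phi x).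
Proof.
have [sphi [K [cK KO phi0]]] := tphi.
have [cphi dphi] := sphi [::]; have [cdphi _] := sphi [:: i].
rewrite /= in cphi dphi cdphi.
have mphi := continuous_measurable_rV cphi.
have mdphi := continuous_measurable_rV cdphi.
have [Phi Phi0 phiM] := bounded_compact_support cphi cK phi0.
have dphi0 x : ~ K x -> partial i phi x = 0.
  move=> nKx; rewrite /partial.
  have clK : closed K by apply: compact_closed => //; exact: norm_hausdorff.
  rewrite (@near_eq_derive _ _ _ phi (cst 0)) ?derive_cst//.
  have : nbhs x (~` K) by apply: open_nbhs_nbhs; split => //; exact: closed_openC.
  by apply: filterS => y /phi0.
have [Phi' Phi'0 dphiM] := bounded_compact_support cdphi cK dphi0.
have [d d0 Kd] := compact_thickening oO cK KO.
(* Steps tending to 0 and never exceeding the margin d around K. *)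
pose t (k : nat) : R := d / k.+1%:R.
have t0 k : 0 < t k by rewrite divr_gt0.
have td k : t k <= d by rewrite ler_pdivrMr// ler_peMr ?(ltW d0)// ler1n.
(* The extension by 0 turns integrals over Omega into integrals over R^n, where translations act. *)
pose vt := v \_ Omega.
have mvt : measurable_fun setT vt by apply/(measurable_restrictT _ mO).
have M0 : Omega !=set0 -> 0 <= M by move=> [x /vM]; exact: le_trans.
have [On0|O0] := pselect (Omega !=set0); last first.
  rewrite (_ : Omega = set0) ?Rintegral_set0 ?oppr0//.
  by apply/seteqP; split => // x Ox; apply: O0; exists x.
move: M0 => /(_ On0) {}M0.
have vtM x : `|vt x| <= M.
  by rewrite /vt /patch; case: ifPn => [/set_mem/vM//|_]; rewrite normr0.
have phi_lip x s : 0 <= s -> `|phi (x + s *: e) - phi x| <= Phi' * s.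
  move=> s0; have [||c _] := @MVT_segment R (fun s => phi (x + s *: e))
     (fun s => partial i phi (x + s *: e)) 0 s s0.
  - by move=> r _; apply: is_derive_line; exact: dphi.
  - apply: derivable_within_continuous => r _.
    by have [] := is_derive_line (dphi i (x + r *: e)).
  - rewrite scale0r addr0 subr0 => ->.
    by rewrite normrM (ger0_norm s0) ler_wpM2r.
have lebT (F : E -> R) (N : R) : measurable_fun setT F -> (forall x, `|F x| <= N) ->
    (forall x, ~ Omega x -> F x = 0) ->
    leb.-integrable setT (EFin \o F) /\ \int[leb]_x F x = \int[leb]_(x in Omega) F x.
  move=> mF FN F0; have FO : F \_ Omega = F.
    apply/funext => x; rewrite /patch; case: ifPn => // /negP nOx.
    by rewrite F0// => Ox; apply: nOx; rewrite inE.
  split; last by rewrite [RHS]Rintegral_mkcond FO.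
  rewrite -FO -restrict_EFin -integrable_mkcond//.
  by apply: (integrable_bounded mO leb_O (M := N)) => //; exact: measurable_funTS.
pose f_ k x := v x * ((phi (x + t k *: e) - phi x) / t k).
pose g_ k x := (vt (x - t k *: e) - vt x) / t k * phi x.
have meas_shift (F : E -> R) (w : E) : measurable_fun setT F -> measurable_fun setT (fun x : E => F (x + w)).
  move=> mF; apply: (measurableT_comp mF); apply: measurable_fun_rV => j.
  by under eq_fun do rewrite mxE; apply: measurable_funD => //; exact: measurable_coord.
have nOphi x : ~ Omega x -> phi x = 0 by move=> nOx; apply: phi0 => /KO.
have nOvt x : ~ Omega x -> vt x = 0.
  by move=> nOx; rewrite /vt /patch memNset.
have vtE x : Omega x -> vt x = v x by move=> Ox; rewrite /vt /patch mem_set.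
have MPhi0 : 0 <= M * Phi by rewrite mulr_ge0.
have leMPhi x y : `|vt x * phi y| <= M * Phi by rewrite normrM ler_pM.
(* Both sides are [(t k)^-1] times a difference of integrals with the common term B; the other
   terms, A and C, are translates of each other by [t k *: e]. *)
have int_fg k : \int[leb]_(x in Omega) f_ k x = \int[leb]_(x in Omega) g_ k x.
  pose A x := vt x * phi (x + t k *: e); pose B x := vt x * phi x.
  pose C x := vt (x - t k *: e) * phi x.
  have mA : measurable_fun setT A by apply: measurable_funM => //; exact: meas_shift.
  have mB : measurable_fun setT B by exact: measurable_funM.
  have mC : measurable_fun setT C by apply: measurable_funM => //; exact: meas_shift.
  have [iA AE] := lebT A _ mA (fun x => leMPhi x _) (fun x nOx => etrans (congr1 ( *%R^~ _) (nOvt x nOx)) (mul0r _)).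
  have [iB BE] := lebT B _ mB (fun x => leMPhi x _) (fun x nOx => etrans (congr1 ( *%R^~ _) (nOvt x nOx)) (mul0r _)).
  have [iC CE] := lebT C _ mC (fun x => leMPhi _ x) (fun x nOx => etrans (congr1 ( *%R _) (nOphi x nOx)) (mulr0 _)).
  have AC : (fun x => C (x + t k *: e)) = A by apply/funext => x; rewrite /C addrK.
  have intAC : \int[leb]_x A x = \int[leb]_x C x.
    by rewrite -(@Rintegral_translation _ _ (t k *: e) C)// AC.
  have sub (F : E -> R) : leb.-integrable setT (EFin \o F) -> leb.-integrable Omega (EFin \o F).
    by apply: integrableS.
  transitivity (\int[leb]_(x in Omega) ((t k)^-1 * (A x - B x))).
    apply: eq_Rintegral => x /set_mem Ox; rewrite /f_ /A /B vtE//; ring.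
  transitivity (\int[leb]_(x in Omega) ((t k)^-1 * (C x - B x))); last first.
    by apply: eq_Rintegral => x _; rewrite /g_ /C /B; ring.
  have iAB : leb.-integrable Omega (EFin \o (fun x => A x - B x)).
    exact: (integrableB mO (sub _ iA) (sub _ iB)).
  have iCB : leb.-integrable Omega (EFin \o (fun x => C x - B x)).
    exact: (integrableB mO (sub _ iC) (sub _ iB)).
  rewrite !RintegralZl// !RintegralB ?sub//; congr (_ * (_ - _)).
  by rewrite -AE -CE.
have tc : t k @[k --> \oo] --> (0 : R).
  by rewrite -[X in _ --> X](mulr0 d); apply: cvgMl_tmp; exact: cvg_harmonic.
have cvgf : \int[leb]_(x in Omega) f_ k x @[k --> \oo] -->
    \int[leb]_(x in Omega) (v x * partial i phi x).
  apply: (Rintegral_bounded_cvg mO leb_O (M := M * Phi')).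
  - move=> k; apply: measurable_funM => //; apply: measurable_funTS.
    by apply: measurable_funM => //; apply: measurable_funB => //; exact: meas_shift.
  - by apply: measurable_funM => //; exact: measurable_funTS.
  - apply: aeW => x Ox; apply: cvgMl_tmp.
    have tc' : t k @[k --> \oo] --> (0 : R)^'.
      move=> P P0; have H : \forall k \near \oo, t k != 0 -> P (t k) := tc _ P0.
      suff : \forall k \near \oo, P (t k) by [].
      by apply: filterS H => k; apply; rewrite gt_eqF ?t0.
    have := cvg_comp _ _ tc' (dphi i x).
    apply: cvg_trans; apply: near_eq_cvg; apply: nearW => k /=.
    by rewrite [RHS]mulrC [x + _]addrC.
  - move=> k x Ox; rewrite normrM ler_pM// ?vM// normrM normfV (gtr0_norm (t0 k)).
    by rewrite ler_pdivrMr// phi_lip// ltW.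
(* The shift of v runs backwards, whence the sign of the limit. On K the quotient is almost
   everywhere eventually constant by [v_diff]; off K everything vanishes with phi. *)
have cvgg : \int[leb]_(x in Omega) g_ k x @[k --> \oo] -->
    \int[leb]_(x in Omega) (- 1 * (G x * phi x)).
  apply: (Rintegral_bounded_cvg mO leb_O (M := L * Phi)).
  - move=> k; apply: measurable_funTS; apply: measurable_funM => //.
    by apply: measurable_funM => //; apply: measurable_funB => //; exact: meas_shift.
  - by apply: measurable_funM => //; apply: measurable_funM => //; exact: measurable_funTS.
  - move: v_diff => [N [mN N0 Nv]]; exists N; split => // x nx; apply: Nv => /= h; apply: nx => Ox.
    have [Kx|nKx] := pselect (K x); last first.
      by rewrite /g_ phi0// !mulr0; under eq_fun do rewrite mulr0; exact: cvg_cst.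
    have := h Ox.
    have Ntc : - t k @[k --> \oo] --> (0 : R) by rewrite -oppr0; exact: cvgN.
    move=> /Ntc nearG.
    have {}nearG : \forall k \near \oo, v (x + - t k *: e) - v x = - t k * G x := nearG.
    apply: cvg_near_cst; apply: filterS nearG => k /=; rewrite scaleNr /g_ vtE; last first.
      apply: (Kd x) => //; rewrite opprB addrC subrK normrZ gtr0_norm//.
      by apply: le_trans (td k); rewrite ler_piMr ?(ltW (t0 k))// norm_delta_mx_le.
    by rewrite vtE// => ->; field; rewrite gt_eqF.
  - move=> k x Ox; have [Kx|nKx] := pselect (K x); last first.
      by rewrite /g_ phi0// mulr0 normr0 mulr_ge0.
    have seg s : 0 <= s <= t k -> Omega (x - s *: e).
      move=> /andP[s0 st]; apply: (Kd x) => //.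
      rewrite opprB addrC subrK normrZ ger0_norm// (le_trans _ (le_trans st (td k)))//.
      by rewrite ler_piMr// norm_delta_mx_le.
    rewrite /g_ normrM ler_pM// !vtE//; last first.
      by apply: seg; rewrite lexx (ltW (t0 k)).
    rewrite normrM normfV (gtr0_norm (t0 k)) ler_pdivrMr//.
    by apply: lipschitz_on_segment => //; exact: ltW.
have iG : leb.-integrable Omega (EFin \o (fun x => G x * phi x)).
  apply: (integrable_bounded mO leb_O (M := L * Phi)).
    by apply: measurable_funM => //; exact: measurable_funTS.
  by move=> x Ox; rewrite normrM ler_pM// GL.
rewrite -mulN1r -RintegralZl//.
have := cvgg; under eq_fun do rewrite -int_fg.
by move=> /(cvg_unique _ cvgf); apply; exact: Rhausdorff.
Qed.

End weak_partial_derivative.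

(** * Square integrability on sets of finite measure *)

Section square_integrable.
Context d {T : measurableType d} {R : realType}.
Variables (mu : {measure set T -> \bar R}) (D : set T).
Hypotheses (mD : measurable D) (muD : (mu D < +oo)%E).

Lemma L2_measurable (f : T -> R) : L2 mu D f -> measurable_fun D f.
Proof.
move=> /sub_Lfun_mfun; rewrite inE/= => mf.
by apply/(measurable_restrictT _ mD).
Qed.

(** The absolute value of f is bounded by [1 + f ^+ 2], and constants are integrable on a set of
    finite measure. *)
Lemma L2_integrable (f : T -> R) : L2 mu D f -> mu.-integrable D (EFin \o f).
Proof.
move=> fL2; have mf := L2_measurable fL2.
have isq : mu.-integrable D (EFin \o (fun x => f x ^+ 2)).
  have := Lfun2_integrable_sqr fL2.
  rewrite [in X in _ -> X]integrable_mkcond// restrict_EFin.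
  congr (mu.-integrable _ (EFin \o _)); apply/funext => x.
  by rewrite /patch; case: ifPn => // _; rewrite expr0n.
have i1 : mu.-integrable D (EFin \o (fun x => 1 + f x ^+ 2)).
  have ic : mu.-integrable D (EFin \o cst (1 : R)).
    by apply: (integrable_bounded mD muD (M := 1)) => // x _; rewrite /= normr1.
  exact: (integrableD mD ic isq).
apply: (le_integrable mD _ _ i1); first exact/measurable_EFinP.
move=> x Dx; rewrite /= lee_fin (ger0_norm (addr_ge0 _ (sqr_ge0 _)))//.
by rewrite -(real_normK (num_real (f x))); have := sqr_ge0 (`|f x| - 1); nra.
Qed.

Lemma integrable_mul_bounded (f h : T -> R) M : mu.-integrable D (EFin \o f) ->
  measurable_fun D h -> (forall x, D x -> `|h x| <= M) ->
  mu.-integrable D (EFin \o (fun x => f x * h x)).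
Proof.
move=> intf mh hM.
have mf : measurable_fun D f by apply/measurable_EFinP; exact: measurable_int intf.
apply: (le_integrable mD _ _ (integrableZl mD M intf)).
  by apply/measurable_EFinP; exact: measurable_funM.
move=> x Dx; rewrite /= lee_fin !normrM mulrC ler_wpM2r//.
exact: le_trans (hM x Dx) (ler_norm _).
Qed.

Lemma bounded_L2 (f : T -> R) M : measurable_fun D f ->
  (forall x, D x -> `|f x| <= M) -> L2 mu D f.
Proof.
move=> mf fM; rewrite /L2.
have mfD : measurable_fun setT (f \_ D) by apply/(measurable_restrictT _ mD).
rewrite inE /=; apply/andP; split; first by rewrite inE.
rewrite inE /= /finite_norm unlock; apply: poweR_lty.
have /integrableP[_] : mu.-integrable setT (EFin \o (fun x => (f \_ D) x ^+ 2)).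
  have : mu.-integrable D (EFin \o (fun x => f x ^+ 2)).
    apply: (integrable_bounded mD muD (M := M ^+ 2)); first exact: measurable_funX.
    by move=> x Dx; rewrite normrX lerXn2r ?nnegrE// ?fM// (le_trans _ (fM x Dx)).
  rewrite [in X in X -> _]integrable_mkcond// restrict_EFin.
  congr (mu.-integrable _ (EFin \o _)); apply/funext => x.
  by rewrite /patch; case: ifPn => // _; rewrite expr0n.
apply: le_lt_trans; rewrite le_eqVlt; apply/orP; left; apply/eqP.
by apply: eq_integral => x _; rewrite /= powR_mulrn// normrX.
Qed.

End square_integrable.

(** * Barycentric coordinates *)

Section simplices.
Context {R : realType} {n : nat}.
Implicit Types (T : 'M[R]_(n.+1, n)) (x : 'rV[R]_n).

Definition homog_mx T : 'M[R]_n.+1 := row_mx (const_mx 1 : 'cV_n.+1) T.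

(** The rows of [homog_mx T] are the vertices preceded by a 1, so the barycentric coordinates l of x
    solve [l *m homog_mx T = (1, x)]; nondegeneracy is the invertibility of this matrix. *)
Definition bary T x : 'rV[R]_n.+1 := row_mx (1%:M : 'M[R]_1) x *m invmx (homog_mx T).

Lemma baryP T x (l : 'rV[R]_n.+1) : Defs.nondegenerate T ->
  (\sum_i l ord0 i = 1 /\ x = l *m T) <-> l = bary T x.
Proof.
move=> T0; have Tu : homog_mx T \in unitmx by rewrite unitmxE unitfE.
have lE : l *m homog_mx T = row_mx ((\sum_i l ord0 i)%:M : 'M[R]_1) (l *m T).
  rewrite /homog_mx (@mul_mx_row _ 1 n.+1 1 n).
  rewrite (_ : l *m const_mx 1 = (\sum_i l ord0 i)%:M)//.
  apply/matrixP => i j; rewrite !ord1 !mxE eqxx mulr1n.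
  by apply: eq_bigr => k _; rewrite mxE mulr1.
split=> [[l1 xE]|->].
  by rewrite /bary xE -l1 -lE mulmxK.
have : bary T x *m homog_mx T = row_mx (1%:M : 'M[R]_1) x by rewrite mulmxKV.
rewrite /homog_mx (@mul_mx_row _ 1 n.+1 1 n) => /(@eq_row_mx _ 1 1 n)[h1 h2].
split=> //; move/matrixP : h1 => /(_ ord0 ord0); rewrite [RHS]mxE eqxx => h1.
by rewrite -[RHS]h1 mxE; apply: eq_bigr => k _; rewrite [X in _ * X]mxE mulr1.
Qed.

Definition bary_cst T i := invmx (homog_mx T) ord0 i.
Definition bary_lin T i j := invmx (homog_mx T) (lift ord0 j) i.

Lemma baryE T x i :
  bary T x ord0 i = bary_cst T i + \sum_j bary_lin T i j * x ord0 j.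
Proof.
rewrite /bary mxE big_ord_recl; congr (_ + _).
  rewrite [X in X * _](_ : _ = 1) ?mul1r//.
  rewrite (_ : ord0 = lshift n (ord0 : 'I_1)); last exact: val_inj.
  by rewrite (@row_mxEl _ 1 1 n) mxE eqxx.
apply: eq_bigr => j _; rewrite mulrC; congr (_ * _).
by rewrite (_ : lift ord0 j = rshift 1 j) ?(@row_mxEr _ 1 1 n)//; exact: val_inj.
Qed.

(** Otherwise column i of an inverse matrix would be zero. This is the hypothesis under which the
    zero set of a barycentric coordinate is null. *)
Lemma bary_neq0 T i : Defs.nondegenerate T ->
  bary_cst T i != 0 \/ exists j, bary_lin T i j != 0.
Proof.
move=> T0; have Tu : homog_mx T \in unitmx by rewrite unitmxE unitfE.
have [c0|] := boolP (bary_cst T i == 0); last by left.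
right; apply: contrapT => nl.
have : (homog_mx T *m invmx (homog_mx T)) i i = 1.
  by rewrite mulmxV// mxE eqxx.
rewrite mxE big_ord_recl [X in _ * X + _](_ : _ = 0); last exact/eqP.
rewrite mulr0 add0r big1 => [/esym/eqP|j _].
  by rewrite oner_eq0.
have [/eqP l0|l0] := boolP (bary_lin T i j == 0); first by rewrite [X in _ * X]l0 mulr0.
by exfalso; apply: nl; exists j.
Qed.

Lemma faceE T I x : Defs.nondegenerate T -> face T I x <->
  (forall i, 0 <= bary T x ord0 i) /\ (forall i, i \notin I -> bary T x ord0 i = 0).
Proof.
move=> T0; split => [[l [l0 lI l1 xE]]|[b0 bI]].
  by have <- := (@baryP T x l T0).1 (conj l1 xE).
by exists (bary T x); have [] := (@baryP T x _ T0).2 erefl; split.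
Qed.

Lemma simplexE T x : Defs.nondegenerate T ->
  simplex T x <-> forall i, 0 <= bary T x ord0 i.
Proof.
move=> T0; rewrite /simplex; split => [/(faceE _ _ T0)[]//|b0].
by apply/(faceE _ _ T0); split => // i; rewrite inE.
Qed.

Definition open_simplex T : set 'rV[R]_n := [set x | forall i, 0 < bary T x ord0 i].

Lemma bary_continuous T i : continuous (fun x => bary T x ord0 i).
Proof.
under eq_fun do rewrite baryE.
apply: continuous_addfun; first exact: cst_continuous.
apply: continuous_bigsum => j; apply: continuous_mulfun.
  exact: cst_continuous.
exact: coord_continuous.
Qed.

Lemma simplex_closed T : Defs.nondegenerate T -> closed (simplex T).
Proof.
move=> T0; rewrite (_ : simplex T =
    \bigcap_(i in [set: 'I_n.+1]) ((fun x => bary T x ord0 i) @^-1` [set t | 0 <= t])).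
  apply: closed_bigI => i _; apply: closed_comp => [x _|]; last exact: closed_ge.
  exact: bary_continuous.
by apply/seteqP; split => x; [move=> /(simplexE _ T0) + i _; exact|move=> h; apply/(simplexE _ T0) => i; exact: h].
Qed.

Lemma open_simplex_open T : open (open_simplex T).
Proof.
rewrite (_ : open_simplex T =
    \big[setI/setT]_(i < n.+1) ((fun x => bary T x ord0 i) @^-1` [set t | 0 < t])).
  elim/big_ind : _ => [|A B|i _]; [exact: openT|exact: openI|].
  apply: open_comp => [x _|]; last exact: open_gt.
  exact: bary_continuous.
rewrite -bigcap_seq; apply/seteqP; split => x h i; first by move=> _; exact: h.
by apply: h; rewrite /= mem_index_enum.
Qed.

Lemma open_simplex_sub T : Defs.nondegenerate T -> open_simplex T `<=` simplex T.
Proof. by move=> T0 x x0; apply/(simplexE _ T0) => i; exact/ltW/x0. Qed.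

Lemma open_simplex_nonempty T : Defs.nondegenerate T -> open_simplex T !=set0.
Proof.
(* The witness is the barycentre, with all weights equal. *)
move=> T0; pose l : 'rV[R]_n.+1 := const_mx n.+1%:R^-1.
have l1 : \sum_i l ord0 i = 1.
  under eq_bigr do rewrite mxE.
  by rewrite sumr_const card_ord -[_ *+ _]mulr_natl mulfV// pnatr_eq0.
exists (l *m T) => i.
rewrite -((@baryP T (l *m T) l T0).1 (conj l1 erefl)) mxE invr_gt0 ltr0n //.
Qed.

End simplices.

(** * Piecewise affine functions *)

Section facets.
Context {R : realType}.

(** The facet is parametrised from its vertex [lift i ord0] along the n edges leaving it, with the
    remaining barycentric weights as parameters; these lie in [0, 1] as nonnegative numbers of sum
    1. *)
Lemma facet_parallelepiped n (T : 'M[R]_(n.+2, n.+1)) i :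
  face T (~: [set i]) `<=` parallelepiped (row (lift i ord0) T)
    (fun k : 'I_n => row (lift i (lift ord0 k)) T - row (lift i ord0) T).
Proof.
move=> x [l [l0 li l1 ->]].
have {}li : l ord0 i = 0 by apply: li; rewrite !inE eqxx.
have split_sum (V : nmodType) (F : 'I_n.+2 -> V) : \sum_k F k =
    F i + (F (lift i ord0) + \sum_(k < n) F (lift i (lift ord0 k))).
  by rewrite (@bigD1_ord _ _ _ _ i)//= big_ord_recl.
have l01 k : l ord0 k <= 1.
  by rewrite -l1 (bigD1 k)//= lerDl sumr_ge0.
exists (fun k => l ord0 (lift i (lift ord0 k))) => [k|]; first by rewrite l0 l01.
move: l1; rewrite split_sum li add0r => /eqP; rewrite eq_sym -subr_eq => /eqP l1.
rewrite mulmx_sum_row split_sum li scale0r add0r -l1 scalerBl scale1r -addrA.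
congr (_ + _); rewrite scaler_suml addrC -sumrB.
by apply: eq_bigr => k _; rewrite scalerBr.
Qed.

Lemma surface_facet n (T : 'M[R]_(n.+1, n)) i : (0 < n)%N ->
  (surface_outer R n (face T (~: [set i])) < +oo)%E.
Proof.
case: n T i => // n T i _.
apply: (@le_lt_trans _ _ (surface_outer R n.+1 (parallelepiped (row (lift i ord0) T)
    (fun k : 'I_n => row (lift i (lift ord0 k)) T - row (lift i ord0) T)))).
  exact/le_outer_measure/facet_parallelepiped.
exact: hausdorff_parallelepiped.
Qed.

Lemma outer_measure_bigsetU_lty (X : Type) (mu : {outer_measure set X -> \bar R})
    (I : eqType) (r : seq I) (F : I -> set X) :
  (forall i, i \in r -> mu (F i) < +oo)%E ->
  (mu (\big[setU/set0]_(i <- r) F i) < +oo)%E.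
Proof.
elim: r => [|i r IH] Fr; first by rewrite big_nil outer_measure0.
rewrite big_cons; apply: (le_lt_trans (outer_measureU2 _ _ _)).
rewrite lte_add_pinfty ?Fr ?mem_head// IH// => j jr.
by apply: Fr; rewrite in_cons jr orbT.
Qed.

End facets.

Section piecewise_affine_functions.
Context {R : realType} {n : nat}.
Local Notation leb := (lebesgue_rV R n).
Variables (Omega : set 'rV[R]_n) (tau : seq 'M[R]_(n.+1, n)).
Hypotheses (oO : open Omega) (bO : bounded_set Omega).
Hypothesis regO : Omega = (closure Omega)°.
Hypothesis ndtau : all (@Defs.nondegenerate R n) tau.
Hypothesis cover : closure Omega = \bigcup_(T in [set` tau]) simplex T.

Let mO : measurable Omega := open_measurable_rV oO.
Let leb_O : (leb Omega < +oo)%E := lebesgue_rV_bounded mO bO.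
Let N := size tau.
Let T (k : 'I_N) := tnth (in_tuple tau) k.
Local Notation E := 'rV[R]_(N * n.+1).

Let ndT k : Defs.nondegenerate (T k).
Proof. by apply: (allP ndtau); exact: mem_tnth. Qed.

Let closureE x : closure Omega x <-> exists k, simplex (T k) x.
Proof.
rewrite cover; split => [[M /= /(tnthP (in_tuple tau))[k ->] Mx]|[k kx]]; first by exists k.
by exists (T k) => //=; exact: mem_tnth.
Qed.

(** An open subset of [closure Omega] lies in its interior, which is Omega by [regO]. *)
Lemma open_simplex_interior k : open_simplex (T k) `<=` Omega.
Proof.
move=> x kx; suff : (closure Omega)° x by rewrite -regO.
have : nbhs x (open_simplex (T k)).
  by apply: open_nbhs_nbhs; split => //; exact: open_simplex_open.
by apply: filterS => y ky; apply/closureE; exists k; exact: open_simplex_sub.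
Qed.

(** Row k of the unflattened matrix holds the constant term (column 0) and then the gradient of the
    k-th affine function; the flat form is the row vector that the abstract inequality works on. *)
Definition coef (C : E) (k : 'I_N) (j : 'I_n.+1) : R := vec_mx C k j.

Definition aff (C : E) (k : 'I_N) (x : 'rV[R]_n) : R :=
  coef C k ord0 + \sum_j coef C k (lift ord0 j) * x ord0 j.

(* The pieces are the simplices made disjoint: on overlaps the first one wins. *)
Definition piece (k : 'I_N) : set 'rV[R]_n :=
  [set x | simplex (T k) x /\ forall j : 'I_N, (j < k)%N -> ~ simplex (T j) x].

Definition glue (F : 'I_N -> 'rV[R]_n -> R) (x : 'rV[R]_n) : R :=
  \sum_k \1_(piece k) x * F k x.

Definition pw (C : E) := glue (aff C).

Definition pwgrad (C : E) (i : 'I_n) := glue (fun k _ => coef C k (lift ord0 i)).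

(** Rules out jumps across common faces, and makes [pw C] coincide with [aff C k] on the whole k-th
    simplex and not just on its piece. *)
Definition compat (C : E) := forall k l x, simplex (T k) x -> simplex (T l) x ->
  aff C k x = aff C l x.

Lemma coef_linear k j : linear (fun C => coef C k j).
Proof. by move=> a C D; rewrite /coef linearP !mxE. Qed.

Lemma aff_linear k x : linear (fun C => aff C k x).
Proof.
move=> a C D; rewrite /aff coef_linear /= scalerDr scaler_sumr addrACA.
congr (_ + _); rewrite -big_split/=; apply: eq_bigr => j _.
by rewrite coef_linear /= mulrDl scalerAl.
Qed.

Lemma glue_linear (F : E -> 'I_N -> 'rV[R]_n -> R) x :
  (forall k, linear (fun C => F C k x)) -> linear (fun C => glue (F C) x).
Proof.
move=> Fl a C D; rewrite /glue scaler_sumr -big_split/=.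
by apply: eq_bigr => k _; rewrite Fl mulrDr scalerAr.
Qed.

Lemma pw_linear x : linear (fun C => pw C x).
Proof. by apply: glue_linear => k; exact: aff_linear. Qed.

Lemma pwgrad_linear i x : linear (fun C => pwgrad C i x).
Proof. by apply: glue_linear => k; exact: coef_linear. Qed.

Lemma measurable_piece k : measurable (piece k).
Proof.
have mT j : measurable (simplex (T j)) by apply: closed_measurable_rV; exact: simplex_closed.
rewrite (_ : piece k = simplex (T k) `&` \bigcap_(j in [set j : 'I_N | (j < k)%N]) ~` simplex (T j)).
  apply: measurableI => //; apply: fin_bigcap_measurable => //.
  by move=> j _; exact: measurableC.
by apply/seteqP; split.
Qed.

Lemma measurable_aff C k : measurable_fun setT (aff C k).
Proof.
apply: measurable_funD => //; apply: measurable_sum => j.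
by apply: measurable_funM => //; exact: measurable_coord.
Qed.

Lemma measurable_glue F : (forall k, measurable_fun setT (F k)) ->
  measurable_fun setT (glue F).
Proof.
move=> mF; apply: measurable_sum => k; apply: measurable_funM => //.
by apply: measurable_indic; exact: measurable_piece.
Qed.

Lemma measurable_pw C : measurable_fun setT (pw C).
Proof. by apply: measurable_glue => k; exact: measurable_aff. Qed.

Lemma measurable_pwgrad C i : measurable_fun setT (pwgrad C i).
Proof. exact: measurable_glue. Qed.

Lemma glueE F k x : piece k x -> glue F x = F k x.
Proof.
move=> kx; rewrite /glue (bigD1 k)//= indicE mem_set// mul1r big1 ?addr0// => l lk.
rewrite indicE memNset ?mul0r// => -[lx ltl].
have [lk'|kl|/val_inj lk'] := ltngtP l k; last by rewrite lk' eqxx in lk.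
  by case: kx => _ /(_ _ lk').
by case: kx => kx _; exact: (ltl _ kl).
Qed.

Lemma piece_ex x : closure Omega x -> exists k, piece k x.
Proof.
move=> /closureE[k0 k0x].
have [|k kx kmin] := @arg_minnP 'I_N k0 (fun k => `[< simplex (T k) x >]) (fun k => k).
  exact/asboolP.
exists k; split; first exact/asboolP.
by move=> j jk /asboolP/kmin; rewrite leqNgt jk.
Qed.

Lemma pwE C k x : compat C -> simplex (T k) x -> pw C x = aff C k x.
Proof.
move=> cC kx; have [|l lx] := @piece_ex x; first by apply/closureE; exists k.
by rewrite /pw (glueE _ lx); apply: cC => //; case: lx.
Qed.

(** A Lipschitz constant common to all pieces that also bounds the gradient, since [weak_partial]
    uses one L for both purposes. *)
Definition coef_norm (C : E) : R := \sum_k \sum_j `|coef C k j|.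

Lemma coef_norm_ge0 C : 0 <= coef_norm C.
Proof. by apply: sumr_ge0 => k _; exact: sumr_ge0. Qed.

Lemma row_coef_le C k : \sum_j `|coef C k j| <= coef_norm C.
Proof.
by rewrite /coef_norm [leRHS](bigD1 k)//= lerDl; apply: sumr_ge0 => l _; exact: sumr_ge0.
Qed.

Lemma coef_le C k j : `|coef C k j| <= coef_norm C.
Proof.
by apply: le_trans (row_coef_le C k); rewrite [leRHS](bigD1 j)//= lerDl; exact: sumr_ge0.
Qed.

Lemma aff_lipschitz C k x y : `|aff C k y - aff C k x| <= coef_norm C * `|y - x|.
Proof.
rewrite /aff opprD addrACA subrr add0r -sumrB.
apply: le_trans (ler_norm_sum _ _ _) _.
apply: le_trans (ler_wpM2r (normr_ge0 _) (row_coef_le C k)).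
rewrite big_ord_recl mulrDl; apply: ler_wpDl; first by rewrite mulr_ge0.
rewrite mulr_suml; apply: ler_sum => j _.
rewrite -mulrBr normrM ler_wpM2l//.
by have := coord_le_norm (y - x) j; rewrite !mxE.
Qed.

(** The finitely many closed simplices that miss x also miss a neighbourhood of it. Hence x and any
    nearby y of [closure Omega] share a simplex, and one affine function compares the values at
    both. *)
Lemma near_simplices x : \forall y \near x, forall k, simplex (T k) y -> simplex (T k) x.
Proof.
suff : forall k, \forall y \near x, simplex (T k) y -> simplex (T k) x.
  exact: (@filter_forall _ _ _ _ (nbhs_filter x)).
move=> k; have [kx|kx] := pselect (simplex (T k) x).
  by apply: (filterS _ (@filterT _ (nbhs x) _)) => y _ _; exact: kx.
have : nbhs x (~` simplex (T k)).
  apply: open_nbhs_nbhs; split => //; apply: closed_openC.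
  exact: simplex_closed.
by apply: filterS => y + ky.
Qed.

Lemma pw_locally_lipschitz C x : compat C -> \forall y \near x, closure Omega y ->
  `|pw C y - pw C x| <= coef_norm C * `|y - x|.
Proof.
move=> cC; apply: filterS (near_simplices x) => y yx /closureE[k ky].
by rewrite (pwE cC ky) (pwE cC (yx k ky)); exact: aff_lipschitz.
Qed.

Lemma pw_continuous C : compat C -> {within closure Omega, continuous (pw C)}.
Proof.
move=> cC; apply/subspace_continuousP => x Ox; apply/cvgrPdist_le => e e0.
have lip := pw_locally_lipschitz x cC.
have near_e : \forall y \near x, `|y - x| <= e / (coef_norm C + 1).
  apply/nbhs_ballP; exists (e / (coef_norm C + 1)) => /=.
    by rewrite divr_gt0// ltr_wpDl// coef_norm_ge0.
  by move=> y; rewrite -ball_normE/= distrC => /ltW.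
rewrite near_withinE; apply: filterS2 lip near_e => y lip ye Oy.
rewrite distrC; apply: le_trans (lip Oy) _.
apply: (@le_trans _ _ ((coef_norm C + 1) * `|y - x|)).
  by rewrite ler_wpM2r// lerDl.
by rewrite mulrC -ler_pdivlMr// ltr_wpDl// coef_norm_ge0.
Qed.

Lemma pwgrad_bounded C i x : `|pwgrad C i x| <= coef_norm C.
Proof.
have [[k kx]|nk] := pselect (exists k, piece k x).
  by rewrite /pwgrad (glueE _ kx) coef_le.
rewrite /pwgrad /glue big1 ?normr0 ?coef_norm_ge0// => k _.
by rewrite indicE memNset ?mul0r// => kx; apply: nk; exists k.
Qed.

Lemma pw_bounded C : exists2 M, 0 <= M & forall x, closure Omega x -> `|pw C x| <= M.
Proof.
have [B [_ /(_ (`|B| + 1))]] := bO.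
rewrite ltr_pwDr ?ler_norm// => /(_ isT) OB.
have clB x : closure Omega x -> `|x| <= `|B| + 1.
  pose S := [set y : 'rV[R]_n | `|y| <= `|B| + 1].
  have cS : closed S.
    suff : closed ((fun y : 'rV[R]_n => `|y|) @^-1` [set t | t <= `|B| + 1]) by [].
    by apply: closed_comp => [y _|]; [exact: norm_continuous|exact: closed_le].
  by move=> /(closure_subset (OB : Omega `<=` S)); rewrite -((closure_id S).1 cS).
exists (coef_norm C * (1 + (`|B| + 1))) => [|x Ox].
  by rewrite mulr_ge0 ?coef_norm_ge0// !addr_ge0.
have [k kx] := piece_ex Ox; rewrite /pw (glueE _ kx) -(subrK (aff C k 0) (aff C k x)).
apply: le_trans (ler_normD _ _) _; rewrite addrC mulrDr mulr1 lerD//.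
  rewrite /aff big1 ?addr0 ?coef_le// => j _; by rewrite mxE mulr0.
apply: le_trans (aff_lipschitz _ _ _ _) _; rewrite subr0.
by rewrite ler_wpM2l ?coef_norm_ge0// clB.
Qed.

Definition skeleton : set 'rV[R]_n :=
  \bigcup_(k in [set: 'I_N]) \bigcup_(i in [set: 'I_n.+1])
    [set x | bary (T k) x ord0 i = 0].

Lemma skeleton_negligible : leb.-negligible skeleton.
Proof.
have bij0 k i : leb.-negligible [set x | bary (T k) x ord0 i = 0].
  pose H : set 'rV[R]_n :=
    [set x | bary_cst (T k) i + \sum_j bary_lin (T k) i j * x ord0 j = 0].
  have H0 : leb H = 0%E := @lebesgue_hyperplane R n _ _ (bary_neq0 i (ndT k)).
  exists H; split => //; last by move=> x /=; rewrite baryE.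
  rewrite (_ : H = (fun x => bary (T k) x ord0 i) @^-1` [set 0]).
    apply: closed_measurable_rV; apply: closed_comp => [x _|]; last exact: closed_eq.
    exact: bary_continuous.
  by apply/seteqP; split => x /=; rewrite baryE.
have fin_neg (I : finType) (F : I -> set 'rV[R]_n) :
    (forall i, leb.-negligible (F i)) -> leb.-negligible (\bigcup_(i in [set: I]) F i).
  move=> Fi; rewrite (_ : \bigcup_(i in _) F i = \big[setU/set0]_(i in I) F i).
    by elim/big_ind : _ => //; [exact: negligible_set0|exact: negligibleU].
  by rewrite -bigcup_seq; apply/seteqP; split => x [i _ ix]; exists i => //=; rewrite mem_index_enum.
by apply: (fin_neg 'I_N) => k; apply: (fin_neg 'I_n.+1).
Qed.

Lemma simplex_off_skeleton k x : ~ skeleton x -> simplex (T k) x -> open_simplex (T k) x.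
Proof.
move=> nx /(simplexE _ (ndT k)) kx i; rewrite lt_def kx andbT.
by apply/eqP => bi; apply: nx; exists k => //; exists i.
Qed.

(** A boundary point lies in a simplex but not in its open part, which is contained in Omega; some
    barycentric coordinate vanishes there, which places the point on a facet. *)
Lemma bdry_surface_lty (A : set 'rV[R]_n) : (0 < n)%N -> A `<=` bdry Omega ->
  (surface_outer R n A < +oo)%E.
Proof.
move=> n0 Ab.
apply: (@le_lt_trans _ _ (surface_outer R n (\big[setU/set0]_(k : 'I_N)
    \big[setU/set0]_(i : 'I_n.+1) face (T k) (~: [set i])))).
  apply: le_outer_measure => x /Ab[/closureE[k kx] nx].
  rewrite -bigcup_seq; exists k; first by rewrite /= mem_index_enum.
  rewrite -bigcup_seq.
  have [[i bi]|ni] := pselect (exists i, bary (T k) x ord0 i = 0).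
    exists i; first by rewrite /= mem_index_enum.
    apply/(faceE _ _ (ndT k)); split; first exact/(simplexE _ (ndT k)).
    by move=> j; rewrite !inE negbK => /eqP ->.
  exfalso; apply: nx; rewrite (_ : Omega° = Omega); last by apply/interior_id.
  apply: (@open_simplex_interior k) => i; rewrite lt_def.
  rewrite (_ : 0 <= _); last by have /(simplexE _ (ndT k)) := kx.
  by rewrite andbT; apply/eqP => bi; apply: ni; exists i.
do 2 (apply: outer_measure_bigsetU_lty => ? _); exact: surface_facet.
Qed.

Definition pwgradV C (x : 'rV[R]_n) : 'rV[R]_n := \row_i pwgrad C i x.

Lemma pw_H1_gradient C u : compat C -> (forall x, Omega x -> u x = pw C x) ->
  H1_gradient Omega u (pwgradV C).
Proof.
move=> cC uC; have [M M0 pwM] := pw_bounded C.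
have Ocl : Omega `<=` closure Omega by exact: subset_closure.
have mu : measurable_fun Omega u.
  apply: (eq_measurable_fun (pw C)); first by move=> x /set_mem/uC.
  by apply: measurable_funTS; exact: measurable_pw.
have uM x : Omega x -> `|u x| <= M by move=> Ox; rewrite uC// pwM//; exact: Ocl.
have gM i x : Omega x -> `|pwgradV C x ord0 i| <= coef_norm C.
  by move=> _; rewrite mxE pwgrad_bounded.
have mg i : measurable_fun Omega (fun x => pwgradV C x ord0 i).
  by under eq_fun do rewrite mxE; apply: measurable_funTS; exact: measurable_pwgrad.
split.
- exact: (bounded_L2 mO leb_O mu uM).
- by move=> i; exact: (bounded_L2 mO leb_O (mg i) (gM i)).
move=> phi i tphi.
apply: (weak_partial (M := M) (L := coef_norm C)) => //.
- exact: coef_norm_ge0.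
- by move=> x; exact: gM.
- move=> x Ox; have nO : nbhs x Omega by exact: open_nbhs_nbhs.
  apply: filterS2 (pw_locally_lipschitz x cC) nO => y lip Oy.
  by rewrite !uC//; apply: lip; exact: Ocl.
have [A [mA A0 sA]] := skeleton_negligible; exists A; split => //.
apply: subset_trans sA => x /=; apply: contra_notP => nx Ox.
have [k kx] := piece_ex (Ocl x Ox).
have := simplex_off_skeleton nx kx.1.
move=> kox; have nk : nbhs x (open_simplex (T k)).
  by apply: open_nbhs_nbhs; split => //; exact: open_simplex_open.
have ce : (fun t : R => x + t *: delta_mx ord0 i) @ (0 : R) --> x.
  have cs : continuous (fun t : R => x + t *: delta_mx ord0 i : 'rV[R]_n).
    by move=> t; apply: cvgD; [exact: cvg_cst|apply: cvgZr_tmp; exact: cvg_id].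
  by have := cs 0; rewrite /continuous_at scale0r addr0.
have {}nk : \forall t \near (0 : R), open_simplex (T k) (x + t *: delta_mx ord0 i) := ce _ nk.
apply: filterS nk => t kt; rewrite !uC//; last exact: (@open_simplex_interior k).
rewrite (pwE cC (open_simplex_sub (ndT k) kt)) (pwE cC kx.1) mxE /pwgrad (glueE _ kx).
rewrite /aff opprD addrACA subrr add0r -sumrB (bigD1 i)//= big1 ?addr0.
  by rewrite !mxE !eqxx /=; ring.
by move=> j /negbTE ji; rewrite !mxE ji /=; ring.
Qed.

Lemma weak_gradient_pw C u G i : compat C -> (forall x, Omega x -> u x = pw C x) ->
  H1_gradient Omega u G -> {ae leb, forall x, Omega x -> G x ord0 i = pwgrad C i x}.
Proof.
move=> cC uC [_ GL2 Gw]; have [_ _ pw_w] := pw_H1_gradient cC uC.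
have iG := L2_integrable mO leb_O (GL2 i).
have mp : measurable_fun Omega (pwgrad C i) := measurable_funTS (@measurable_pwgrad C i).
have ip : leb.-integrable Omega (EFin \o pwgrad C i) :=
  integrable_bounded mO leb_O mp (fun x _ => pwgrad_bounded C i x).
have iN : leb.-integrable Omega (EFin \o (fun x => G x ord0 i - pwgrad C i x)).
  exact: (integrableB mO iG ip).
suff : leb.-negligible (Omega `&` [set x | G x ord0 i - pwgrad C i x != 0]).
  apply: negligibleS => x /= /not_implyP[Ox /eqP ne]; split => //=.
  by rewrite subr_eq0.
apply: (du_bois_reymond oO iN) => phi tphi.
have [sphi [K [cK KO phi0]]] := tphi; have [/= cphi _] := sphi [::].
have [Phi _ phiM] := bounded_compact_support cphi cK phi0.
have mphi : measurable_fun Omega phi := measurable_funTS (continuous_measurable_rV cphi).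
under eq_Rintegral do rewrite mulrBl.
rewrite RintegralB//; last 2 first.
- exact: (integrable_mul_bounded mO iG mphi (fun x _ => phiM x)).
- exact: (integrable_mul_bounded mO ip mphi (fun x _ => phiM x)).
have := pw_w phi i tphi; rewrite Gw// => /oppr_inj ->.
by apply/eqP; rewrite subr_eq0; apply/eqP; apply: eq_Rintegral => x _; rewrite mxE.
Qed.

(** * The energy form on coefficients and its kernel *)

Definition energy (C D : E) : R :=
  \int[leb]_(x in Omega) (\sum_i pwgrad C i x * pwgrad D i x).

Let measurable_pwgrad_dot C D : measurable_fun setT (fun x => \sum_i pwgrad C i x * pwgrad D i x).
Proof. by apply: measurable_sum => i; apply: measurable_funM; exact: measurable_pwgrad. Qed.

Let integrable_pwgrad_dot C D :
  leb.-integrable Omega (EFin \o (fun x => \sum_i pwgrad C i x * pwgrad D i x)).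
Proof.
apply: (integrable_bounded mO leb_O (M := \sum_(i < n) coef_norm C * coef_norm D)).
  exact: measurable_funTS.
move=> x _; apply: le_trans (ler_norm_sum _ _ _) _; apply: ler_sum => i _.
by rewrite normrM ler_pM// pwgrad_bounded.
Qed.

Lemma dirichlet_pw C D u v : compat C -> compat D ->
  (forall x, Omega x -> u x = pw C x) -> (forall x, Omega x -> v x = pw D x) ->
  dirichlet Omega u v = energy C D.
Proof.
move=> cC cD uC vD.
(* [grad] is a choice; it is a weak gradient because [pwgradV C] shows that one exists. *)
have Gu : H1_gradient Omega u (grad Omega u).
  by apply: getPex; exists (pwgradV C); exact: pw_H1_gradient.
have Gv : H1_gradient Omega v (grad Omega v).
  by apply: getPex; exists (pwgradV D); exact: pw_H1_gradient.
rewrite /dirichlet /energy /Rintegral; congr fine; apply: ae_eq_integral => //.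
- apply/measurable_EFinP; apply: measurable_sum => i; apply: measurable_funM.
    by have [_ /(_ i)/(L2_measurable mO)] := Gu.
  by have [_ /(_ i)/(L2_measurable mO)] := Gv.
- by apply/measurable_EFinP; exact: measurable_funTS.
have aeu : {ae leb, forall x i, Omega x -> grad Omega u x ord0 i = pwgrad C i x}.
  by apply: filter_forall => i; exact: weak_gradient_pw Gu.
have aev : {ae leb, forall x i, Omega x -> grad Omega v x ord0 i = pwgrad D i x}.
  by apply: filter_forall => i; exact: weak_gradient_pw Gv.
apply: filterS2 aeu aev => x ux vx Ox; congr EFin.
by apply: eq_bigr => i _; rewrite ux// vx.
Qed.

Lemma energy_linear C : linear (energy C).
Proof.
move=> a D D'; rewrite /energy [X in _ = X + _]/GRing.scale/= -RintegralZl//.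
have iaD : leb.-integrable Omega (EFin \o (fun x => a * \sum_i pwgrad C i x * pwgrad D i x)).
  exact: (integrableZl mO a (integrable_pwgrad_dot C D)).
rewrite -RintegralD//; apply: eq_Rintegral => x _.
rewrite mulr_sumr -big_split/=; apply: eq_bigr => i _.
by rewrite pwgrad_linear /GRing.scale/=; ring.
Qed.

Lemma energy_sym C D : energy C D = energy D C.
Proof. by apply: eq_Rintegral => x _; apply: eq_bigr => i _; rewrite mulrC. Qed.

Lemma energy_ge0 C : 0 <= energy C C.
Proof. by apply: Rintegral_ge0 => x _; apply: sumr_ge0 => i _; rewrite -expr2 sqr_ge0. Qed.

(* piece only selects one of the simplices containing a point, so the gradient
   on the k-th simplex is reached through another simplex l overlapping it. *)
Lemma energy_eq0 D : compat D -> energy D D = 0 ->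
  forall k i, coef D k (lift ord0 i) = 0.
Proof.
move=> cD D0 k i.
pose S x := \sum_i pwgrad D i x * pwgrad D i x.
have S0 x : 0 <= S x by apply: sumr_ge0 => j _; rewrite -expr2 sqr_ge0.
have : {ae leb, forall x, Omega x -> (S x)%:E = 0%E}.
  have mS : measurable_fun Omega (EFin \o S).
    by apply/measurable_EFinP; apply: measurable_funTS; exact: measurable_pwgrad_dot.
  apply/(ae_eq_integral_abs leb mO mS).
  under eq_integral do rewrite /= ger0_norm//.
  have : (energy D D)%:E = 0%E by rewrite D0.
  by rewrite /energy /Rintegral fineK// (integrable_fin_num mO)// integrable_pwgrad_dot.
move=> aeS; have negl := negligibleU aeS skeleton_negligible.
(* An open simplex has positive measure, so it is not covered by the two null sets to be avoided. *)
have [x kx [Sx nx]] : exists2 x, open_simplex (T k) x & S x = 0 /\ ~ skeleton x.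
  apply: contrapT => nex.
  have := lebesgue_rV_open_gt0 (@open_simplex_open _ _ (T k)) (open_simplex_nonempty (ndT k)).
  rewrite (_ : leb _ = 0%E) ?ltxx//.
  apply/(negligibleP leb); first exact: open_measurable_rV (@open_simplex_open _ _ _).
  apply: negligibleS negl => x kx; apply: contrapT => nA; apply: nex; exists x => //.
  split; last by move=> sx; apply: nA; right.
  apply: contrapT => Sx; apply: nA; left => /=.
  by move=> /(_ (open_simplex_interior kx))[].
have Ox := open_simplex_interior kx.
have [l lx] := piece_ex (subset_closure Ox).
have cl j : coef D l (lift ord0 j) = 0.
  have /eqP := Sx; rewrite psumr_eq0 => [|? _]; last by rewrite -expr2 sqr_ge0.
  move=> /allP/(_ j (mem_index_enum _)); rewrite mulf_eq0 orbb => /eqP.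
  by rewrite /pwgrad (glueE _ lx).
have lox := simplex_off_skeleton nx lx.1.
have nkl : nbhs x (open_simplex (T k) `&` open_simplex (T l)).
  by apply: open_nbhs_nbhs; split => //; apply: openI; exact: open_simplex_open.
have /nbhs_ballP[e /= e0 ekl] := nkl.
(* A small move along the i-th axis inside both open simplices: the l-th function is constant, the
   k-th agrees with it at x and y, so its i-th slope is 0. *)
pose y := x + (e / 2) *: delta_mx ord0 i.
have [ky ly] : (open_simplex (T k) `&` open_simplex (T l)) y.
  apply: ekl; rewrite -ball_normE/= opprD addNKr normrN normrZ gtr0_norm ?divr_gt0//.
  apply: (@le_lt_trans _ _ (e / 2)); last by rewrite gtr_pMr// invf_lt1 ?ltr1n.
  by rewrite ler_piMr ?norm_delta_mx_le// ltW// divr_gt0.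
have sub j z : open_simplex (T j) z -> simplex (T j) z by exact: open_simplex_sub.
have := cD k l y (sub _ _ ky) (sub _ _ ly); have := cD k l x (sub _ _ kx) (sub _ _ lox).
rewrite /aff; under [X in _ = _ + X]eq_bigr do rewrite cl mul0r.
move=> h1; under [X in _ = _ + X]eq_bigr do rewrite cl mul0r.
rewrite -h1 => /addrI/eqP; rewrite -subr_eq0 -sumrB (bigD1 i)//= big1 ?addr0 => [|j /negbTE ji].
  rewrite /y !mxE !eqxx mulr1 -mulrBr addrAC subrr add0r mulf_eq0 => /orP[/eqP//|].
  by rewrite gt_eqF// divr_gt0.
by rewrite /y !mxE ji mulr0 addr0 subrr.
Qed.

(** The simplices carrying the value 0 and those carrying another value have closed unions A and B,
    disjoint by compatibility and covering [closure Omega]; connectedness and the given zero leave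
    only A. *)
Lemma compat_eq0 D : connected Omega -> compat D ->
  (forall k i, coef D k (lift ord0 i) = 0) ->
  (exists2 x, closure Omega x & pw D x = 0) -> D = 0.
Proof.
move=> /connected_closure conO cD grad0 [x0 Ox0 Dx0].
have affE k x : aff D k x = coef D k ord0.
  by rewrite /aff big1 ?addr0// => j _; rewrite grad0 mul0r.
pose Z (P : pred R) := \bigcup_(k in [set k | P (coef D k ord0)]) simplex (T k).
have cZ P : closed (Z P).
  by apply: closed_bigcup => [|k _]; [exact: finite_finset|exact: simplex_closed].
have ZO P : Z P `<=` closure Omega by move=> x [k _ kx]; apply/closureE; exists k.
pose A := Z (fun c => c == 0); pose B := Z (fun c => c != 0).
have AB x : closure Omega x -> A x <-> ~ B x.
  move=> /closureE[k kx]; split => [[l /= /eqP l0 lx] [l' /= l'0 l'x]|nB].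
    by move: l'0; rewrite -(affE l' x) (cD _ _ _ l'x lx) affE l0 eqxx.
  by exists k => //=; apply/negPn/negP => k0; apply: nB; exists k.
have AO : A = closure Omega.
  apply: conO.
  - have [k kx] := (closureE x0).1 Ox0; exists x0, k => //=.
    by rewrite -(affE k x0) -(pwE cD kx) Dx0.
  - exists (~` B); first exact/closed_openC/cZ.
    apply/seteqP; split => x; first by move=> Ax; have Ox := ZO _ _ Ax; split => //; exact/AB.
    by move=> [Ox] /(AB _ Ox).
  - exists A; first exact: cZ.
    by apply/seteqP; split => x; [move=> Ax; split => //; exact: ZO Ax|case].
have c0 k : coef D k ord0 = 0.
  have [x kx] := open_simplex_nonempty (ndT k).
  have {}kx := open_simplex_sub (ndT k) kx.
  have : A x by rewrite AO; apply/closureE; exists k.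
  by move=> [l /= /eqP <- lx]; rewrite -(affE k x) -(affE l x); exact: cD.
apply: (can_inj (@vec_mxK _ _ _)); rewrite linear0; apply/matrixP => k j.
rewrite [RHS]mxE -/(coef D k j); case: (unliftP ord0 j) => [i ->|->]; first exact: grad0.
exact: c0.
Qed.

Lemma pwD C D x : pw (C + D) x = pw C x + pw D x.
Proof. by have := pw_linear x 1 C D; rewrite !scale1r. Qed.

Lemma pwZ a C x : pw (a *: C) x = a * pw C x.
Proof.
have pw0 : pw 0 x = 0 by apply: (addrI (pw 0 x)); rewrite -pwD !addr0.
by have := pw_linear x a C 0; rewrite addr0 pw0 addr0.
Qed.

Lemma pwB C D x : pw (C - D) x = pw C x - pw D x.
Proof. by rewrite pwD -scaleN1r pwZ mulN1r. Qed.

Lemma compat_lin a C D : compat C -> compat D -> compat (a *: C + D).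
Proof.
move=> cC cD k l x kx lx; rewrite !aff_linear.
by rewrite (cC k l x kx lx) (cD k l x kx lx).
Qed.

Lemma compatB C D : compat C -> compat D -> compat (C - D).
Proof. by move=> cC cD; rewrite addrC -scaleN1r; exact: compat_lin. Qed.

(** Infinite families are allowed, since the constraints on C are indexed by points of space. *)
Lemma closed_linear_constraints (I : Type) (P : set I) (f : I -> E -> R) (A : set R) :
  (forall i, linear (f i)) -> closed A -> closed [set C | forall i, P i -> A (f i C)].
Proof.
move=> fl cA; rewrite (_ : [set _ | _] = \bigcap_(i in P) (f i @^-1` A))//.
apply: closed_bigI => i _; apply: closed_comp => // x _.
exact: linear_form_continuous.
Qed.

Lemma closed_compat : closed compat.
Proof.
rewrite (_ : compat = [set C | forall p : 'I_N * 'I_N * 'rV[R]_n,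
    [set p | simplex (T p.1.1) p.2 /\ simplex (T p.1.2) p.2] p ->
    [set 0] (aff C p.1.1 p.2 - aff C p.1.2 p.2)]).
  apply: (closed_linear_constraints (I := 'I_N * 'I_N * 'rV[R]_n)
    (f := fun p C => aff C p.1.1 p.2 - aff C p.1.2 p.2)); last exact: closed_eq.
  by move=> p a C D; rewrite !aff_linear scalerBr opprD addrACA.
apply/seteqP; split => [C cC [[k l] x] /= [kx lx]|C cC k l x kx lx].
  by rewrite (cC k l x) ?subrr.
by apply/eqP; rewrite -subr_eq0; apply/eqP; exact: (cC (k, l, x)).
Qed.

(** * Admissible coefficients and their differences *)

Section constraints.
Variables (Gamma1 : set 'rV[R]_n) (b : R).
Hypothesis Gamma1_sub : Gamma1 `<=` closure Omega.

Definition feasible : set E :=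
  [set C | [/\ compat C, forall x, closure Omega x -> 0 <= pw C x &
               forall x, Gamma1 x -> pw C x = b]].

(** The counterpart of V_0: the linear space of differences, on which the energy is definite. *)
Definition direction : set E := [set C | compat C /\ forall x, Gamma1 x -> pw C x = 0].

Lemma feasible_closed : closed feasible.
Proof.
rewrite (_ : feasible = compat `&` ([set C | forall x, closure Omega x -> [set t | 0 <= t] (pw C x)] `&`
    [set C | forall x, Gamma1 x -> [set b] (pw C x)])).
  apply: closedI; first exact: closed_compat.
  apply: closedI; apply: (@closed_linear_constraints _ _ (fun x C => pw C x));
    try exact: pw_linear; [exact: closed_ge|exact: closed_eq].
by apply/seteqP; split => C; [case|case=> ? []].
Qed.

Lemma direction_closed : closed direction.
Proof.
apply: closedI; first exact: closed_compat.
apply: (@closed_linear_constraints _ Gamma1 (fun x C => pw C x) [set 0]); first exact: pw_linear.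
exact: closed_eq.
Qed.

Lemma directionZ a C : direction C -> direction (a *: C).
Proof.
move=> [cC C0]; split => [k l x kx lx|x /C0 Cx]; last by rewrite pwZ Cx mulr0.
have cC0 : compat 0 by rewrite -(subrr C); exact: compatB.
by have := compat_lin a cC cC0; rewrite addr0; exact.
Qed.

Lemma feasible_convex C D t : feasible C -> feasible D -> 0 <= t <= 1 ->
  feasible (C + t *: (D - C)).
Proof.
move=> [cC C0 Cb] [cD D0 Db] /andP[t0 t1]; split.
- by rewrite addrC; apply: compat_lin => //; exact: compatB.
- by move=> x Ox; have := C0 x Ox; have := D0 x Ox; rewrite pwD pwZ pwB; nra.
- by move=> x Gx; rewrite pwD pwZ pwB Cb// Db// subrr mulr0 addr0.
Qed.

Lemma feasibleB C D : feasible C -> feasible D -> direction (D - C).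
Proof.
move=> [cC _ Cb] [cD _ Db]; split; first exact: compatB.
by move=> x Gx; rewrite pwB Cb// Db// subrr.
Qed.

Lemma pw_Kh C : feasible C -> Kh Omega Gamma1 b tau (pw C).
Proof.
move=> [cC C0 Cb]; split => //; first exact: pw_continuous.
move=> _ /(tnthP (in_tuple tau))[k ->].
exists (coef C k ord0), (\row_j coef C k (lift ord0 j)) => x kx.
by rewrite (pwE cC kx); congr (_ + _); apply: eq_bigr => j _; rewrite mxE.
Qed.

Lemma Kh_pw v : Kh Omega Gamma1 b tau v ->
  exists2 C, feasible C & forall x, closure Omega x -> v x = pw C x.
Proof.
move=> [_ v0 vb vP1].
have /choice[r rP] : forall k : 'I_N, exists r : 'rV[R]_n.+1, forall x, simplex (T k) x ->
    v x = r ord0 ord0 + \sum_j r ord0 (lift ord0 j) * x ord0 j.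
  move=> k; have [c [d cd]] := vP1 (T k) (mem_tnth _ _).
  exists (\row_i if unlift ord0 i is Some j then d ord0 j else c) => x kx.
  rewrite cd// mxE unlift_none; congr (_ + _).
  by apply: eq_bigr => j _; rewrite mxE liftK.
pose C : E := mxvec (\matrix_(k, j) r k ord0 j).
have Caff k x : simplex (T k) x -> v x = aff C k x.
  move=> kx; rewrite (rP k)// /aff /coef /C mxvecK mxE; congr (_ + _).
  by apply: eq_bigr => j _; rewrite mxE.
have cC : compat C by move=> k l x kx lx; rewrite -!Caff.
have vC x : closure Omega x -> v x = pw C x.
  by move=> /closureE[k kx]; rewrite (pwE cC kx) (Caff k).
exists C => //; split => // x => [Ox|Gx]; first by rewrite -vC// v0.
by rewrite -vC ?vb//; exact: Gamma1_sub.
Qed.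

Lemma feasible_nonempty : 0 <= b -> feasible !=set0.
Proof.
(* The constant function b is admissible. *)
move=> b0; have [|C] := @Kh_pw (cst b); last by exists C.
split => //; first by move=> x; exact: cst_continuous.
move=> M _; exists b, 0 => x _ /=.
by rewrite big1 ?addr0// => j _; rewrite mxE mul0r.
Qed.

Lemma energy_definite C : connected Omega -> Gamma1 !=set0 -> direction C ->
  energy C C = 0 -> C = 0.
Proof.
move=> conO [x Gx] [cC C0] /(energy_eq0 cC) grad0.
by apply: compat_eq0 => //; exists x; [exact: Gamma1_sub|exact: C0].
Qed.

End constraints.

(** The map j is the identity in both uses; it accounts for the surface integral being taken on R^n
    with another sigma-algebra than the Borel one. *)
Lemma Rintegral_pw_linear d (X : measurableType d) (mu : {measure set X -> \bar R})
    (D : set X) (f : X -> R) (j : X -> 'rV[R]_n) :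
  measurable D -> (mu D < +oo)%E -> L2 mu D f ->
  measurable_fun setT j -> (forall x, D x -> closure Omega (j x)) ->
  linear (fun C => \int[mu]_(x in D) (f x * pw C (j x))).
Proof.
move=> mD muD fL2 mj jO a C C'.
have ifC (C'' : E) : mu.-integrable D (EFin \o (fun x => f x * pw C'' (j x))).
  have [M _ pwM] := pw_bounded C''.
  apply: (integrable_mul_bounded (M := M) mD (L2_integrable mD muD fL2)).
    by apply: measurable_funTS; apply: measurableT_comp mj; exact: measurable_pw.
  by move=> x Dx; apply: pwM; exact: jO.
rewrite [X in _ = X + _]/GRing.scale/= -RintegralZl//.
have iaC : mu.-integrable D (EFin \o (fun x => a * (f x * pw C (j x)))).
  exact: (integrableZl mD a (ifC C)).
rewrite -RintegralD//; apply: eq_Rintegral => x _.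
by rewrite pwD pwZ; ring.
Qed.

End piecewise_affine_functions.

Theorem theorem2p1 (R : realType) (n : nat) (n_gt0 : (0 < n)%N)
    (Omega Gamma1 Gamma2 : set 'rV[R]_n)
    (Omega_polygonal : polygonal_domain Omega)
    (bdry_split : bdry Omega = Gamma1 `|` Gamma2)
    (Gamma_disjoint : Gamma1 `&` Gamma2 = set0)
    (Gamma1_measurable : measurable (Gamma1 : set (surface_type R n)))
    (Gamma2_measurable : measurable (Gamma2 : set (surface_type R n)))
    (Gamma1_pos : (0 < surface R n Gamma1)%E)
    (g q : 'rV[R]_n -> R) (b : R)
    (g_L2 : L2 (lebesgue_rV R n) Omega g)
    (b_gt0 : 0 < b)
    (q_L2 : L2 (surface R n) Gamma2 q)
    (h : R) (h_gt0 : 0 < h)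
    (tau : seq 'M[R]_(n.+1, n))
    (tau_triangulation : triangulation Omega tau)
    (tau_h : longest_side tau = h) :
  exists2 u : 'rV[R]_n -> R,
    discrete_solution Omega Gamma1 Gamma2 g q b tau u &
    forall w : 'rV[R]_n -> R,
      discrete_solution Omega Gamma1 Gamma2 g q b tau w ->
      forall x, closure Omega x -> w x = u x.
Proof.
have [oO conO On0 bO [regO _]] := Omega_polygonal.
have [ndtau cover _] := tau_triangulation.
have mO := open_measurable_rV oO.
have G1b : Gamma1 `<=` bdry Omega by rewrite bdry_split; exact: subsetUl.
have G2b : Gamma2 `<=` bdry Omega by rewrite bdry_split; exact: subsetUr.
have G1cl : Gamma1 `<=` closure Omega by move=> x /G1b[].
have G2cl : Gamma2 `<=` closure Omega by move=> x /G2b[].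
have Ocl : Omega `<=` closure Omega by exact: subset_closure.
have G1n0 : Gamma1 !=set0.
  apply/set0P/eqP => G10; move: Gamma1_pos.
  by rewrite G10 measure0 ltxx.
have lebO : (lebesgue_rV R n Omega < +oo)%E := lebesgue_rV_bounded mO bO.
have surf2 : (surface R n Gamma2 < +oo)%E.
  exact: (bdry_surface_lty oO regO ndtau cover n_gt0 G2b).
pose E := 'rV[R]_(size tau * n.+1).
pose l (C : E) := \int[lebesgue_rV R n]_(x in Omega) (g x * pw C x) -
  \int[surface R n]_(x in Gamma2) (q x * pw C x).
have l_linear : linear l.
  have l1 := Rintegral_pw_linear bO ndtau cover mO lebO g_L2 (@measurable_id _ _ setT) Ocl.
  have l2 := Rintegral_pw_linear bO ndtau cover Gamma2_measurable surf2 q_L2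
    (@measurable_hausdorff_id R n n.-1) G2cl.
  by move=> a C D; rewrite /l l1 l2 scalerBr opprD addrACA.
pose S := feasible Omega Gamma1 b (tau := tau).
pose a : E -> E -> R := energy Omega (tau := tau).
have [C0 SC0 C0min] : exists2 C, S C & forall D, S D -> l (D - C) <= a C (D - C).
  apply: (@variational_inequality R _ a _ _ _ l S (@direction R n tau Gamma1)) => //.
  - move=> C; exact: energy_linear.
  - exact: energy_sym.
  - exact: energy_ge0.
  - exact: (feasible_nonempty cover G1cl (ltW b_gt0)).
  - exact: feasible_closed.
  - exact: feasible_convex.
  - exact: direction_closed.
  - exact: directionZ.
  - exact: feasibleB.
  - move=> C; exact: (energy_definite oO bO regO ndtau cover G1cl conO G1n0).
(* Elements of K_h matter only on [closure Omega], so the passage to coefficients is made for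
   arbitrary functions that agree there with [pw C] and [pw D]. *)
have Kvar u C v D : S C -> S D -> (forall x, closure Omega x -> u x = pw C x) ->
    (forall x, closure Omega x -> v x = pw D x) ->
    dirichlet Omega u (v \- u) = a C (D - C) /\
    \int[lebesgue_rV R n]_(x in Omega) (g x * (v x - u x)) -
      \int[surface R n]_(x in Gamma2) (q x * (v x - u x)) = l (D - C).
  move=> [cC _ _] [cD _ _] uC vD; split.
    apply: (dirichlet_pw oO bO regO ndtau cover cC (compatB cD cC)).
      by move=> x /Ocl; exact: uC.
    by move=> x /Ocl Ox; rewrite /= pwB uC// vD.
  by congr (_ - _); apply: eq_Rintegral => x /set_mem xD; rewrite pwB uC ?vD//;
    [exact: Ocl|exact: Ocl|exact: G2cl|exact: G2cl].
exists (pw C0).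
  split; first exact: (pw_Kh ndtau cover SC0).
  move=> v /(Kh_pw cover G1cl)[D SD vD].
  by have [-> ->] := Kvar (pw C0) C0 v D SC0 SD (fun _ _ => erefl) vD; exact: C0min.
move=> w [wK wmin].
have [D SD wD] := Kh_pw cover G1cl wK.
have wC0 := wmin _ (pw_Kh ndtau cover SC0).
have [E1 E2] := Kvar w D (pw C0) C0 SD SC0 wD (fun _ _ => erefl).
have lB (C C' : E) : l (C - C') = l C - l C' by exact: linear_formB.
have aB (C C' C'' : E) : a C (C' - C'') = a C C' - a C C''.
  by apply: linear_formB; exact: energy_linear.
have aBl (C C' C'' : E) : a (C' - C'') C = a C' C - a C'' C.
  by rewrite /a !(energy_sym _ _ C) -/(a _ _) aB.
(* The inequality for [C0] tested with D and the one for w tested with [pw C0] add up to the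
   nonpositivity of the energy of [D - C0]. *)
have energy0 : a (D - C0) (D - C0) = 0.
  have DC_ge0 : 0 <= a (D - C0) (D - C0) by exact: energy_ge0.
  have := C0min _ SD; move: wC0 DC_ge0; rewrite E1 E2 !(lB, aBl, aB).
  by move=> ? ? ?; lra.
have DC : D - C0 = 0.
  apply: (energy_definite oO bO regO ndtau cover G1cl conO G1n0) energy0.
  exact: feasibleB SC0 SD.
by move=> x Ox; rewrite wD//; move/eqP: DC; rewrite subr_eq0 => /eqP ->.
Qed.
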